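(* Let $f:I\to I$ be a $C^{r}$ ($r>1$) map of a compact interval $I$, and let $\bar\eta=\{\eta_m\}_{m\ge1}$ be any sequence of positive real numbers converging to $0$. Then the metric entropy $\mu\mapsto h_\mu(f)$ is upper semi-continuous on $\mathcal M_{\bar\eta,inv}(f)$ (endowed with the weak$^*$ topology).
   Context: $h_\mu(f)$ is the Kolmogorov–Sinai entropy. $\mathcal M_{inv}(f)$ is the set of all $f$-invariant Borel probability measures on $I$, and $\mathcal P(I)$ the set of all Borel probability measures on $I$, with the weak$^*$ topology. Let $\Sigma_f=\{x\in I: f'(x)=0\}$ and fix a decreasing sequence $\{V_m\}_{m\ge1}$ of open neighborhoods of $\Sigma_f$ with $d_H(V_m,\Sigma_f)\to0$ as $m\to\infty$, $d_H$ being the Hausdorff distance. Define $$\mathcal P_{\bar\eta}(f)=\Big\{\nu\in\mathcal P(I):\ \Big|\int_{V_m}\log|f'(x)|\,d\nu(x)\Big|\le\eta_m\ \ \forall m\ge1\Big\},\qquad \mathcal M_{\bar\eta,inv}(f)=\mathcal P_{\bar\eta}(f)\cap\mathcal M_{inv}(f)$$ (with $\log0=-\infty$, so that $\nu(\Sigma_f)=0$ for $\nu\in\mathcal P_{\bar\eta}(f)$). *)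

(* Defs.v *)
From HB Require Import structures.
From mathcomp Require Import all_boot all_order all_algebra.
From mathcomp Require Import all_classical all_reals all_analysis.

Set Implicit Arguments.
Unset Strict Implicit.
Unset Printing Implicit Defensive.

Import Order.TTheory GRing.Theory Num.Theory.
Import numFieldNormedType.Exports.

Local Open Scope classical_set_scope.
Local Open Scope ring_scope.

(* A map I -> I on a compact interval I of R is a function f : R -> R mapping
   I into I; its values outside of I are irrelevant. *)

Section SmoothMaps.
Context {R : realType}.
Implicit Types (I : set R) (f : R -> R) (k : nat) (r x y : R).

(* Limits of difference quotients are taken within I: at the endpoints of an
   interval I this is the one-sided derivative. *)
Definition derivable_in I f x :=
  cvg ((f y - f x) / (y - x) @[y --> within I x^']).

Definition deriv_in I f x : R :=
  lim ((f y - f x) / (y - x) @[y --> within I x^']).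

Definition derivn_in I k f : R -> R := iter k (deriv_in I) f.

Definition continuously_derivable_in I k f :=
  (forall i x, (i < k)%N -> I x -> derivable_in I (derivn_in I i f) x) /\
  {within I, continuous (derivn_in I k f)}.

(* r = k + alpha with k the integer part of r and 0 <= alpha < 1: f is C^k and
   its k-th derivative is alpha-Hoelder. When r is an integer, alpha = 0 and,
   since 0 `^ 0 = 1, the last condition only says that the k-th derivative has
   bounded oscillation, so that C^r has its usual meaning on a compact I. *)
Definition smooth_in I r f :=
  let k := Num.truncn r in
  continuously_derivable_in I k f /\
  exists C : R, forall x y, I x -> I y ->
    `|derivn_in I k f x - derivn_in I k f y| <= C * `|x - y| `^ (r - k%:R).

Definition critical_set I f : set R := [set x | I x /\ deriv_in I f x = 0].

End SmoothMaps.

(* edist_inf set0 is +oo and the supremum of no distances is 0, so that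
   hausdorff_dist A set0 = +oo for A nonempty and hausdorff_dist set0 set0 = 0. *)
Definition hausdorff_dist {R : realType} (A B : set R) : \bar R :=
  maxe 0%E (maxe (ereal_sup [set edist_inf B x | x in A])
                 (ereal_sup [set edist_inf A x | x in B])).

(* V_1, V_2, ... is indexed from 0: V_m is V m.-1. Neighborhoods are open
   relatively to I. *)
Definition shrinking_open_nbhds {R : realType} (I S : set R)
    (V : nat -> set R) :=
  [/\ forall m, exists2 U : set R, open U & V m = U `&` I,
      forall m, S `<=` V m,
      forall m, V m.+1 `<=` V m &
      hausdorff_dist (V m) S @[m --> \oo] --> 0%E].

Definition upper_semicontinuous {X : topologicalType} {R : realType}
    (h : X -> \bar R) :=
  forall x (a : R), (h x < a%:E)%E -> \forall y \near x, (h y < a%:E)%E.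

Section WeakStar.
Context {R : realType}.

Definition continuous_in (I : set R) :=
  {phi : R -> R | {within I, continuous phi}}.

Definition integrals (I : set R) (mu : probability (measurableTypeR R) R) :
    {ptws continuous_in I -> R} :=
  fun phi => (\int[mu]_(x in I) (sval phi x))%R.

(* Borel probability measures on R with the coarsest topology making
   mu |-> \int[mu]_(x in I) phi x continuous for all phi in C(I). *)
Definition weak_star (I : set R) := initial_topology (@integrals I).

HB.instance Definition _ (I : set R) := Topological.on (weak_star I).

(* A Borel probability measure on I is identified with its extension by 0,
   i.e. a Borel probability measure on R giving full mass to I. *)
Definition borel_prob (I : set R) : set (weak_star I) :=
  [set mu : probability (measurableTypeR R) R | mu I = 1%E].
Arguments borel_prob I _ : clear implicits.

Definition invariant_prob (I : set R) (f : R -> R) : set (weak_star I) :=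
  borel_prob I `&` [set mu : probability (measurableTypeR R) R |
    forall A : set (measurableTypeR R), measurable A ->
      mu (I `&` f @^-1` A) = mu A].
Arguments invariant_prob I f _ : clear implicits.

(* lne 0 = -oo; the derivative of a C^1 map is bounded on I, so the integral of
   log|f'| always makes sense in [-oo, +oo[. *)
Definition prob_eta (I : set R) (f : R -> R) (V : nat -> set R)
    (eta : nat -> R) : set (weak_star I) :=
  borel_prob I `&` [set nu : probability (measurableTypeR R) R | forall m,
    (`| \int[nu]_(x in V m) lne (`|deriv_in I f x|)%:E | <= (eta m)%:E)%E].
Arguments prob_eta I f V eta _ : clear implicits.

Definition invariant_prob_eta I f V eta : set (weak_star I) :=
  prob_eta I f V eta `&` invariant_prob I f.

End WeakStar.

Arguments invariant_prob_eta {R} I f V eta _.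

Section Entropy.
Context {R : realType}.
Implicit Types (I : set R) (f : R -> R) (mu : probability (measurableTypeR R) R).

Definition measurable_partition I k (P : 'I_k -> set (measurableTypeR R)) :=
  [/\ forall i, measurable (P i), trivIset setT P & \bigcup_i P i = I].

(* The cell of P \/ f^-1 P \/ ... \/ f^-(n-1) P with itinerary w. *)
Definition cylinder I f k (P : 'I_k -> set R) n (w : {ffun 'I_n -> 'I_k}) :
    set (measurableTypeR R) :=
  [set x | I x /\ forall i : 'I_n, P (w i) (iter i f x)].

Definition entropyn I f mu k (P : 'I_k -> set R) n : R :=
  - \sum_(w : {ffun 'I_n -> 'I_k})
      (let p := fine (mu (cylinder I f P w)) in p * ln p).

Definition entropy_partition I f mu k (P : 'I_k -> set R) : R :=
  lim (entropyn I f mu P n / n%:R @[n --> \oo]).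

Definition KS_entropy I f mu : \bar R :=
  ereal_sup [set h | exists k (P : 'I_k -> set R),
    measurable_partition I P /\ h = (entropy_partition I f mu P)%:E].

End Entropy.

(* Main.v *)
Require Import Defs.
From mathcomp Require Import all_boot all_order all_algebra.
From mathcomp Require Import all_classical all_reals all_analysis.
From mathcomp Require Import measurable_realfun ring lra.
Import Order.TTheory GRing.Theory Num.Theory.
Import numFieldNormedType.Exports.
Local Open Scope classical_set_scope.
Local Open Scope ring_scope.
Set Implicit Arguments.
Unset Strict Implicit.
Unset Printing Implicit Defensive.

(** Small-scale entropy of an interval map can only come from the neighborhood of
    its critical set, and a uniform bound on the integral of log|f'| there leaves
    no room for it.

    Let P be a partition of I into short intervals. Where f is monotone on the
    cells, a P-itinerary of length n confines a point to a set on which f and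
    its first n iterates are all monotone. On such a set the itinerary with
    respect to any N cut points takes at most n N + 1 values ([card_thr_codes]),
    and a polynomial count costs no entropy in the limit.

    Inside V_m the cells of P may contain critical points, even infinitely many.
    They are refined there by a label: the integer part k of - log|f'(x)|
    together with the position of x in a grid of mesh d_k. Since f' is Hoelder
    continuous, d_k can be taken exponential in k and such that f' keeps its sign
    within distance d_k of a point of level k ([hoelder_resolution]), so that f is
    monotone on the cells of the refined partition ([good_monotone]). Level k has
    at most A exp (gamma k) labels, hence the entropy of the label is bounded by
    small terms plus a constant times the integral of - log|f'| over V_m, that is,
    by a constant times eta_m ([ent_label_le]). To stay with finite partitions,
    the levels beyond K are merged into one label; its mass is at most eta_m / K,
    and K tends to infinity while the length n of the itineraries is fixed
    ([ent_block_thr_le]). As all finite measurable partitions are approximated by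
    cut points ([approximable_fmeas]), it follows that h_mu(f) exceeds h_mu(f, P)
    by at most e, for all mu in the class at once ([uniform_tail]).

    It remains to choose the end points of the cells of P outside the atoms of a
    given mu0. Then the cells of the joins P^n are continuity sets, so that
    mu |-> H_mu(P^n) / n is upper semicontinuous at mu0 ([ent_near]), and
    h_mu(f, P) is the infimum over n of these averages ([cvg_entropy_rate]). *)

(** * The function - p ln p *)

Section Phi.
Context {R : realType}.
Implicit Types p q : R.

Definition phi p : R := - (p * ln p).

Lemma phi0 : phi 0 = 0. Proof. by rewrite /phi mul0r oppr0. Qed.

Lemma phi_ge0 p : 0 <= p <= 1 -> 0 <= phi p.
Proof.
by move=> /andP[p0 p1]; rewrite oppr_ge0 mulr_ge0_le0// ln_le0.
Qed.

(** Concavity: [phi] lies below its tangent at [q]. Every upper bound on an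
    entropy below comes from this inequality, with a convenient choice of the
    weights [q]. *)
Lemma phi_tangent p q : 0 <= p -> 0 < q -> phi p <= - (p * ln q) + q - p.
Proof.
rewrite le_eqVlt => /predU1P[<-|p0] q0.
  by rewrite phi0 !mul0r; lra.
have : ln (q / p) <= q / p - 1.
  have := expR_ge1Dx (ln (q / p)).
  by rewrite lnK ?posrE ?divr_gt0//; lra.
rewrite ln_div ?posrE// => h.
have : p * (ln q - ln p) <= p * (q / p - 1) by rewrite ler_pM2l.
have -> : p * (q / p - 1) = q - p by field; rewrite gt_eqF.
by rewrite /phi; lra.
Qed.

Lemma phi_subadd p q : 0 <= p -> 0 <= q -> phi (p + q) <= phi p + phi q.
Proof.
rewrite le_eqVlt => /predU1P[<-|p0]; first by rewrite add0r phi0 add0r.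
rewrite le_eqVlt => /predU1P[<-|q0]; first by rewrite addr0 phi0 addr0.
rewrite /phi -opprD lerN2 mulrDl lerD// ler_pM2l// ler_ln ?posrE ?addr_gt0//.
  by rewrite lerDl ltW.
by rewrite lerDr ltW.
Qed.

Lemma phi_sum_le (F : Type) (s : seq F) (P : pred F) (p : F -> R) :
  (forall t, 0 <= p t) ->
  phi (\sum_(t <- s | P t) p t) <= \sum_(t <- s | P t) phi (p t).
Proof.
move=> p0; suff: 0 <= \sum_(t <- s | P t) p t /\
  phi (\sum_(t <- s | P t) p t) <= \sum_(t <- s | P t) phi (p t) by case.
elim/big_ind2 : _ => [|x1 x2 y1 y2 [x10 x12] [y10 y12]|t _].
- by rewrite phi0.
- split; first exact: addr_ge0.
  by rewrite (le_trans (phi_subadd _ _))// lerD.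
- by split.
Qed.

(** A mass spread over at most [N] atoms gains at most [ln N] per unit: take
    all weights of the tangent inequality equal. *)
Lemma phi_sum_card (F : finType) (p : F -> R) (S : {set F}) (N : nat) :
  (forall u, 0 <= p u) -> (0 < N)%N -> (#|S| <= N)%N ->
  (forall u, u \notin S -> p u = 0) ->
  \sum_u phi (p u) <= phi (\sum_u p u) + (\sum_u p u) * ln N%:R.
Proof.
move=> p0 N0 SN pS; have : 0 <= \sum_u p u by exact: sumr_ge0.
rewrite le_eqVlt => /predU1P[s0|s0].
  rewrite -s0 phi0 mul0r addr0 big1// => u _.
  have /psumr_eq0P -> // : \sum_u p u = 0 by [].
  by rewrite phi0.
set s := \sum_u p u in s0 *; have NR : 0 < N%:R :> R by rewrite ltr0n.
pose q := s / N%:R; have q0 : 0 < q by rewrite divr_gt0.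
rewrite (bigID (mem S))/= [X in _ + X]big1 ?addr0; last first.
  by move=> u uS; rewrite pS// phi0.
have sS : \sum_(u in S) p u = s.
  by rewrite /s [in RHS](bigID (mem S))/= [X in _ = _ + X]big1 ?addr0.
apply: (@le_trans _ _ (\sum_(u in S) (- (p u * ln q) + q - p u))).
  by apply: ler_sum => u _; exact: phi_tangent.
rewrite 2!big_split/= !sumrN -mulr_suml sS sumr_const -[q *+ _]mulr_natl.
rewrite /q ln_div ?posrE// /phi.
have : #|S|%:R * (s / N%:R) <= s.
  by rewrite mulrCA ger_pMr// ler_pdivrMr// mul1r ler_nat.
by rewrite mulrBr; lra.
Qed.

End Phi.

(** * Entropy of finite-valued variables *)

Section PairSums.
Context {R : nmodType} (F G : finType).
Implicit Types f : F * G -> R.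

Lemma sum_pair f : \sum_t f t = \sum_u \sum_v f (u, v).
Proof. by rewrite pair_big; apply: eq_bigr => -[]. Qed.

Lemma sum_snd f v : \sum_(t | t.2 == v) f t = \sum_u f (u, v).
Proof.
rewrite big_mkcond sum_pair; apply: eq_bigr => u _ /=.
by rewrite -big_mkcond big_pred1_eq.
Qed.

End PairSums.

Section Variables.
Context {T : Type}.

(** Relations between partitions, such as refinement, are all expressed in this
    form, which avoids naming the factorization map. *)
Definition determined (F G : Type) (X : T -> F) (Y : T -> G) :=
  forall x y, Y x = Y y -> X x = X y.

Definition joint (F G : Type) (X : T -> F) (Y : T -> G) x := (X x, Y x).

End Variables.

Section Law.
Context {R : realType} d (T : measurableType d) (mu : probability T R).

(** A finite measurable partition is handled as the variable that sends a point
    to the index of its cell: joins are pairs, refinements are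
    [determined], and pulling back by a map is composition. *)
Definition fmeas (F : finType) (X : T -> F) :=
  forall t, measurable (X @^-1` [set t]).

Definition mass (A : set T) : R := fine (mu A).

Definition law (F : finType) (X : T -> F) (t : F) : R := mass (X @^-1` [set t]).

Definition ent (F : finType) (X : T -> F) : R := \sum_t phi (law X t).

Lemma mass_ge0 A : 0 <= mass A. Proof. exact: fine_ge0. Qed.

Lemma massE A : measurable A -> mu A = (mass A)%:E.
Proof. by move=> mA; rewrite fineK// fin_num_measure. Qed.

Lemma mass_le1 A : measurable A -> mass A <= 1.
Proof. by move=> mA; rewrite -lee_fin -massE// probability_le1. Qed.

Lemma mass_le A B : measurable A -> measurable B -> A `<=` B ->
  mass A <= mass B.
Proof. by move=> mA mB AB; rewrite -lee_fin -!massE// le_measure ?inE. Qed.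

Lemma mass_setU_le A B : measurable A -> measurable B ->
  mass (A `|` B) <= mass A + mass B.
Proof.
move=> mA mB; have : (mu (A `|` B) <= mu A + mu B)%E by exact: measureU2.
by rewrite !massE ?lee_fin//; exact: measurableU.
Qed.

Lemma mass_setC_full I : measurable I -> mu I = 1%E -> mass (~` I) = 0.
Proof. by move=> mI muI; rewrite /mass probability_setC// muI subee. Qed.

Lemma measureI_full I A : measurable I -> mu I = 1%E -> measurable A ->
  mu (I `&` A) = mu A.
Proof.
move=> mI muI mA; have mIA : measurable (I `&` A) by exact: measurableI.
have mC : measurable (~` I) by exact: measurableC.
rewrite !massE//; congr EFin; apply/eqP; rewrite eq_le mass_le//=.
have := mass_setU_le mIA mC; rewrite mass_setC_full// addr0.
apply: le_trans; apply: mass_le => //; first exact: measurableU.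
by move=> x Ax; have [Ix|nI] := pselect (I x); [left|right].
Qed.

Lemma fmeas_preimage (F : finType) (X : T -> F) (B : set F) :
  fmeas X -> measurable (X @^-1` B).
Proof.
move=> mX; have -> : X @^-1` B = \bigcup_(t in B) (X @^-1` [set t]).
  apply/seteqP; split=> [x Bx|x [t Bt /= Xt]]; first by exists (X x).
  by rewrite /preimage/= Xt.
by apply: fin_bigcup_measurable => //; exact: finite_finset.
Qed.

Lemma fmeas_comp (F G : finType) (h : F -> G) (X : T -> F) :
  fmeas X -> fmeas (h \o X).
Proof. by move=> mX t; exact: (fmeas_preimage (h @^-1` [set t])). Qed.

Lemma measure_preimage_seq (F : finType) (X : T -> F) (s : seq F) :
  fmeas X -> uniq s ->
  mu (X @^-1` [set` s]) = (\sum_(t <- s) mu (X @^-1` [set t]))%E.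
Proof.
move=> mX; elim: s => [_|t s IH /= /andP[ts us]].
  by rewrite big_nil set_nil preimage_set0 measure0.
rewrite big_cons -IH// -measureU//.
- congr (mu _); apply/seteqP; split=> x /=; rewrite inE.
    by move=> /predU1P.
  by move=> h; apply/predU1P.
- exact: fmeas_preimage.
- by rewrite -subset0 => x /= [->]; rewrite (negbTE ts).
Qed.

Lemma mass_preimage (F : finType) (X : T -> F) (B : pred F) : fmeas X ->
  mass (X @^-1` [set t | B t]) = \sum_(t | B t) law X t.
Proof.
move=> mX; apply: EFin_inj; rewrite -massE; last exact: fmeas_preimage.
have -> : [set t | B t] = [set` enum B].
  by apply/seteqP; split => t; rewrite /= mem_enum.
rewrite measure_preimage_seq ?enum_uniq// big_enum_cond/= -sumEFin.
under eq_bigl => t do rewrite andbT.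
by apply: eq_bigr => t _; rewrite /law -massE.
Qed.

Lemma sum_law (F : finType) (X : T -> F) : fmeas X -> \sum_t law X t = 1.
Proof.
move=> mX; rewrite -(mass_preimage xpredT)//.
rewrite [X in mass X](_ : _ = setT); last by apply/seteqP.
by rewrite /mass probability_setT.
Qed.

Lemma law_comp (F G : finType) (h : F -> G) (X : T -> F) u : fmeas X ->
  law (h \o X) u = \sum_(t | h t == u) law X t.
Proof.
move=> mX; rewrite -mass_preimage//; congr mass.
by apply/seteqP; split=> x /=; [move=> ->|move/eqP].
Qed.

Lemma law_ge0 (F : finType) (X : T -> F) t : 0 <= law X t.
Proof. exact: mass_ge0. Qed.

Lemma law_le1 (F : finType) (X : T -> F) t : fmeas X -> law X t <= 1.
Proof. by move=> mX; exact: mass_le1. Qed.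

Lemma ent_ge0 (F : finType) (X : T -> F) : fmeas X -> 0 <= ent X.
Proof.
by move=> mX; apply: sumr_ge0 => t _; rewrite phi_ge0 ?law_ge0 ?law_le1.
Qed.

Lemma ent_comp_le (F G : finType) (h : F -> G) (X : T -> F) : fmeas X ->
  ent (h \o X) <= ent X.
Proof.
move=> mX; rewrite /ent [leRHS](partition_big h xpredT)//=.
apply: ler_sum => u _; rewrite law_comp//.
by apply: phi_sum_le => t; exact: law_ge0.
Qed.

Lemma determinedP (F G : finType) (X : T -> F) (Y : T -> G) (x0 : T) :
  determined X Y -> exists h, X = h \o Y.
Proof.
move=> XY; exists (fun u => X (xget x0 (Y @^-1` [set u]))).
apply/funext => x /=; apply: XY; apply/esym.
by case: xgetP => [y _ //|/(_ x)]; move/(_ erefl).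
Qed.

(** The space is inhabited since it carries a probability; a point of it is the
    default value for the factorization map. *)
Lemma ent_le (F G : finType) (X : T -> F) (Y : T -> G) :
  fmeas Y -> determined X Y -> ent X <= ent Y.
Proof.
move=> mY XY.
have [x0|T0] := pselect (exists x : T, True); last first.
  suff : (0 : R) = 1 by move/eqP; rewrite eq_sym oner_eq0.
  have := sum_law mY; rewrite big1// => t _; apply/eqP.
  rewrite /law /mass [X in mu X](_ : _ = set0) ?measure0//.
  by apply/seteqP; split=> x //= _; apply: T0; exists x.
by have [h ->] := determinedP (proj1_sig (cid x0)) XY; exact: ent_comp_le.
Qed.

Lemma ent_eq (F G : finType) (X : T -> F) (Y : T -> G) :
  fmeas X -> fmeas Y -> determined X Y -> determined Y X -> ent X = ent Y.
Proof. by move=> *; apply/eqP; rewrite eq_le !ent_le. Qed.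

Lemma fmeas_joint (F G : finType) (X : T -> F) (Y : T -> G) :
  fmeas X -> fmeas Y -> fmeas (joint X Y).
Proof.
move=> mX mY [u v]; have -> : joint X Y @^-1` [set (u, v)] =
    X @^-1` [set u] `&` Y @^-1` [set v].
  by apply/seteqP; split=> x; rewrite /joint /preimage/=; case=> -> ->.
exact: measurableI.
Qed.

Lemma law_jointr (F G : finType) (X : T -> F) (Y : T -> G) v :
  fmeas X -> fmeas Y -> law Y v = \sum_u law (joint X Y) (u, v).
Proof.
move=> mX mY; rewrite (_ : Y = snd \o joint X Y)// law_comp; last first.
  exact: fmeas_joint.
exact: sum_snd.
Qed.

(** The conditional entropy H(X | Y). *)
Definition cent (F G : finType) (X : T -> F) (Y : T -> G) : R :=
  ent (joint X Y) - ent Y.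

Lemma entE (F G : finType) (h : F -> G) (X : T -> F) : fmeas X ->
  ent (h \o X) = \sum_t - (law X t * ln (law (h \o X) (h t))).
Proof.
move=> mX; rewrite /ent [RHS](partition_big h xpredT)//=.
apply: eq_bigr => u _; rewrite /phi [X in - (X * _)]law_comp// big_distrl/= -sumrN.
by apply: eq_bigr => t /eqP ->.
Qed.

(** Positivity of the conditional mutual information of [X] and [Y] given [Z].
    The weights for the tangent inequality are those that make [X] and [Y]
    independent given [Z]; they sum to at most 1. *)
Lemma ent_submod (F G H : finType) (X : T -> F) (Y : T -> G) (Z : T -> H) :
  fmeas X -> fmeas Y -> fmeas Z ->
  ent (joint (joint X Y) Z) + ent Z <= ent (joint X Z) + ent (joint Y Z).
Proof.
move=> mX mY mZ; set W := joint (joint X Y) Z.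
have mW : fmeas W by do 2!apply: fmeas_joint => //.
pose hxz (t : F * G * H) := (t.1.1, t.2).
pose hyz (t : F * G * H) := (t.1.2, t.2).
pose hz (t : F * G * H) := t.2.
have law_le (K : finType) (h : F * G * H -> K) t : law W t <= law (h \o W) (h t).
  rewrite law_comp// (bigD1 t)//= lerDl sumr_ge0// => *; exact: law_ge0.
pose a u z := law (hxz \o W) (u, z).
pose b v z := law (hyz \o W) (v, z).
pose c z := law (hz \o W) z.
pose q (t : F * G * H) := a t.1.1 t.2 * b t.1.2 t.2 / c t.2.
have -> : ent Z = ent (hz \o W) by [].
have -> : ent (joint X Z) = ent (hxz \o W) by [].
have -> : ent (joint Y Z) = ent (hyz \o W) by [].
have -> : ent W = ent (id \o W) by [].
rewrite !entE// -!big_split/= -subr_ge0 -sumrB.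
have q1 : \sum_t q t <= 1.
  rewrite -(sum_law mZ) sum_pair exchange_big/=; apply: ler_sum => z _.
  have az : \sum_u a u z = law Z z by rewrite -(law_jointr z mX mZ).
  have bz : \sum_v b v z = law Z z by rewrite -(law_jointr z mY mZ).
  rewrite sum_pair /q/=.
  under eq_bigr => u _ do rewrite -mulr_suml -mulr_sumr bz.
  rewrite -!mulr_suml az; have [->|Zz] := eqVneq (law Z z) 0.
    by rewrite mul0r mul0r.
  by rewrite mulfK.
rewrite -(sum_law mW) -subr_ge0 -sumrB in q1.
apply: le_trans q1 _; apply: ler_sum => t _.
have := law_ge0 W t; rewrite le_eqVlt => /predU1P[w0|w0].
  rewrite -w0 !mul0r; suff : 0 <= q t by lra.
  by rewrite !mulr_ge0 ?invr_ge0// law_ge0.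
have apos := lt_le_trans w0 (law_le _ hxz t).
have bpos := lt_le_trans w0 (law_le _ hyz t).
have cpos := lt_le_trans w0 (law_le _ hz t).
have qpos : 0 < q t by rewrite divr_gt0 ?mulr_gt0.
have := phi_tangent (ltW w0) qpos.
rewrite /phi ln_div ?posrE ?mulr_gt0// lnM ?posrE//.
rewrite (_ : id \o W = W)// -[a _ _]/(law (hxz \o W) (hxz t)).
rewrite -[b _ _]/(law (hyz \o W) (hyz t)) -[c _]/(law (hz \o W) (hz t)).
by rewrite mulrBr mulrDr; lra.
Qed.

Lemma ent_le_cent (F G : finType) (X : T -> F) (Y : T -> G) :
  fmeas X -> fmeas Y -> ent X <= ent Y + cent X Y.
Proof.
move=> mX mY; rewrite addrC subrK ent_le//; first exact: fmeas_joint.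
by move=> x y [].
Qed.

Lemma cent_le (F F' G : finType) (X : T -> F) (X' : T -> F') (Y : T -> G) :
  fmeas X' -> fmeas Y -> determined X (joint X' Y) -> cent X Y <= cent X' Y.
Proof.
move=> mX mY XX'; rewrite lerB// ent_le//; first exact: fmeas_joint.
by move=> x y e; rewrite /joint (XX' _ _ e) (congr1 snd e : Y x = Y y).
Qed.

Lemma cent_cond_le (F G G' : finType) (X : T -> F) (Y : T -> G) (Y' : T -> G') :
  fmeas X -> fmeas Y -> fmeas Y' -> determined Y Y' -> cent X Y' <= cent X Y.
Proof.
move=> mX mY mY' YY'; have := ent_submod mX mY' mY.
have -> : ent (joint (joint X Y') Y) = ent (joint X Y').
  apply: ent_eq; do ?exact: fmeas_joint.
  - by do 2?apply: fmeas_joint.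
  - by move=> x y [eX eY]; rewrite /joint eX eY (YY' _ _ eY).
  - by move=> x y [eX eY _]; rewrite /joint eX eY.
have -> : ent (joint Y' Y) = ent Y'.
  apply: ent_eq => //; first exact: fmeas_joint.
  - by move=> x y eY; rewrite /joint eY (YY' _ _ eY).
  - by move=> x y [].
by rewrite /cent; lra.
Qed.

Lemma cent_joint (F G H : finType) (X : T -> F) (Y : T -> G) (Z : T -> H) :
  fmeas X -> fmeas Y -> fmeas Z ->
  cent (joint X Y) Z <= cent X Z + cent Y Z.
Proof. by move=> mX mY mZ; have := ent_submod mX mY mZ; rewrite /cent; lra. Qed.

Lemma cent_joint2 (F F' G G' : finType)
    (X : T -> F) (X' : T -> F') (Y : T -> G) (Y' : T -> G') :
  fmeas X -> fmeas X' -> fmeas Y -> fmeas Y' ->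
  cent (joint X X') (joint Y Y') <= cent X Y + cent X' Y'.
Proof.
move=> mX mX' mY mY'; have mYY' := fmeas_joint mY mY'.
apply: le_trans (cent_joint _ _ _) _ => //.
by apply: lerD; apply: cent_cond_le => // x y [].
Qed.

Lemma cent_triangle (F G H : finType) (X : T -> F) (Y : T -> G) (Z : T -> H) :
  fmeas X -> fmeas Y -> fmeas Z -> cent X Z <= cent X Y + cent Y Z.
Proof.
move=> mX mY mZ; have mYZ := fmeas_joint mY mZ.
have : cent X (joint Y Z) <= cent X Y by apply: cent_cond_le => // x y [].
have : ent (joint X Z) <= ent (joint X (joint Y Z)).
  by apply: ent_le; [exact: fmeas_joint|move=> x y [eX _ eZ]; rewrite /joint eX eZ].
by rewrite /cent; lra.
Qed.

Lemma ent_const (F : finType) (X : T -> F) :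
  fmeas X -> (forall x y, X x = X y) -> ent X <= 0.
Proof.
move=> mX cX; rewrite (le_trans (ent_le (Y := fun=> tt) _ _))//.
  by move=> t; case: (pselect (t = tt)) => [->|]; rewrite ?preimage_cst; case: ifP.
rewrite /ent big1// => t _.
rewrite /law (_ : _ @^-1` _ = setT); last by apply/seteqP; split=> // x _; case: t.
by rewrite /mass probability_setT/= /phi ln1 mulr0 oppr0.
Qed.

Lemma cent_le_ent (F G : finType) (X : T -> F) (Y : T -> G) :
  fmeas X -> fmeas Y -> cent X Y <= ent X.
Proof.
move=> mX mY.
have mtt : fmeas (fun _ : T => tt).
  by move=> t; rewrite preimage_cst; case: ifP.
apply: le_trans (cent_cond_le mX mtt mY _) _ => //.
rewrite /cent lerBlDr (le_trans (ent_le (Y := X) _ _))//.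
  by move=> x y eX; rewrite /joint eX.
by rewrite lerDl ent_ge0.
Qed.

Lemma cent_extend (F G : finType) (X : T -> F) (Y : T -> G) :
  fmeas X -> fmeas Y -> cent (joint Y X) Y <= ent X.
Proof.
move=> mX mY; apply: le_trans (cent_le_ent mX mY); apply: cent_le => //.
by move=> x y [eX eY]; rewrite /joint eX eY.
Qed.

Lemma ent_joint_le (F G : finType) (X : T -> F) (Y : T -> G) :
  fmeas X -> fmeas Y -> ent (joint X Y) <= ent X + ent Y.
Proof. by move=> mX mY; have := cent_le_ent mX mY; rewrite /cent; lra. Qed.

(** Given [Y = v], a variable that takes at most [M] values has entropy at most
    [ln M]. On the values [v] that escape this count, the number of all values
    of [X] serves instead, at the price of the mass of these [v]. *)
Lemma cent_count (F G : finType) (X : T -> F) (Y : T -> G) (B : pred G) (M : nat) :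
  fmeas X -> fmeas Y -> (0 < M)%N ->
  (forall v, B v ->
     (#|[set u | `[< exists x, X x = u /\ Y x = v >]]%SET| <= M)%N) ->
  cent X Y <= ln M%:R + mass (Y @^-1` [set v | ~~ B v]) * ln #|F|%:R.
Proof.
move=> mX mY M0 cB.
have key v (N : nat) (N0 : (0 < N)%N) :
    (#|[set u | `[< exists x, X x = u /\ Y x = v >]]%SET| <= N)%N ->
    \sum_u phi (law (joint X Y) (u, v)) <= phi (law Y v) + law Y v * ln N%:R.
  set S := [set u | _]%SET => SN.
  rewrite (law_jointr v mX mY); apply: (phi_sum_card (S := S)) => // [u|u].
    exact: law_ge0.
  rewrite inE => /asboolPn nu; rewrite /law /mass (_ : _ @^-1` _ = set0) ?measure0//.
  by apply/seteqP; split=> x //= [eX eY]; apply: nu; exists x.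
rewrite /cent {1}/ent sum_pair exchange_big/= lerBlDr /ent.
have lnM : 0 <= ln M%:R :> R by rewrite ln_ge0// ler1n.
have lnF : 0 <= ln #|F|%:R :> R.
  by case: #|F| => [|n]; [rewrite ln0|rewrite ln_ge0// ler1n].
apply: (@le_trans _ _ (\sum_v (phi (law Y v) + law Y v * ln M%:R +
    (if ~~ B v then law Y v * ln #|F|%:R else 0)))).
  apply: ler_sum => v _; have pv := law_ge0 Y v.
  have pM : 0 <= law Y v * ln M%:R by rewrite mulr_ge0.
  case: ifPn => [nB|/negbNE Bv]; last by rewrite addr0; apply: key => //; exact: cB.
  have [F0|F0] := posnP #|F|.
    rewrite big1; last by move=> u _; move: F0; rewrite (cardD1 u).
    by rewrite !addr_ge0 ?mulr_ge0 ?phi_ge0 ?pv ?law_le1.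
  by have := key v _ F0 (max_card _); lra.
by rewrite !big_split/= -big_mkcond/= -!mulr_suml -(mass_preimage (predC B))// sum_law//; lra.
Qed.

End Law.

(** * Itineraries and entropy rate *)

Section Itineraries.
Context {T : Type} (g : T -> T).

Definition block (F : finType) (X : T -> F) n x : {ffun 'I_n -> F} :=
  [ffun i : 'I_n => X (iter i g x)].

Lemma blockP (F : finType) (X : T -> F) n x y : block X n x = block X n y <->
  forall i, (i < n)%N -> X (iter i g x) = X (iter i g y).
Proof.
split=> [e i ni|h]; last by apply/ffunP => i; rewrite !ffunE h.
by have /ffunP/(_ (Ordinal ni)) := e; rewrite !ffunE.
Qed.

Lemma blockSrP (F : finType) (X : T -> F) n x y :
  joint (block X n) (X \o iter n g) x = joint (block X n) (X \o iter n g) y <->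
  block X n.+1 x = block X n.+1 y.
Proof.
split=> [[/blockP eB eX]|/blockP e].
  apply/blockP => i; rewrite ltnS leq_eqVlt.
  by move=> /predU1P[->|ni]; [|exact: eB].
congr pair; last exact: (e n).
by apply/blockP => i ni; rewrite e// ltnS ltnW.
Qed.

End Itineraries.

Section Blocks.
Context {R : realType} d (T : measurableType d) (mu : probability T R) (g : T -> T).
Context (mg : measurable_fun setT g)
  (mu_inv : forall A, measurable A -> mu (g @^-1` A) = mu A).

Lemma measurable_preimage_iter n A :
  measurable A -> measurable (iter n g @^-1` A).
Proof.
move=> mA; elim: n => [//|n IH].
have -> : iter n.+1 g @^-1` A = g @^-1` (iter n g @^-1` A).
  by apply/funext => x; rewrite /preimage/= -iterSr.
by rewrite -[X in measurable X]setTI; exact: mg.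
Qed.

Lemma measure_preimage_iter n A :
  measurable A -> mu (iter n g @^-1` A) = mu A.
Proof.
move=> mA; elim: n => [//|n IH].
have -> : iter n.+1 g @^-1` A = g @^-1` (iter n g @^-1` A).
  by apply/funext => x; rewrite /preimage/= -iterSr.
by rewrite mu_inv//; exact: measurable_preimage_iter.
Qed.

Lemma fmeas_iter (F : finType) (X : T -> F) n : fmeas X -> fmeas (X \o iter n g).
Proof. by move=> mX t; exact: (measurable_preimage_iter n (mX t)). Qed.

Lemma ent_iter (F : finType) (X : T -> F) n :
  fmeas X -> ent mu (X \o iter n g) = ent mu X.
Proof.
move=> mX; apply: eq_bigr => t _; congr phi; congr fine.
exact: (measure_preimage_iter n (mX t)).
Qed.

Lemma fmeas_block (F : finType) (X : T -> F) n : fmeas X -> fmeas (block g X n).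
Proof.
move=> mX w; have -> : block g X n @^-1` [set w] =
    \bigcap_(i in [set: 'I_n]) (iter i g @^-1` (X @^-1` [set w i])).
  apply/seteqP; split => x /=; first by move=> <- i _; rewrite /block/= ffunE.
  by move=> h; apply/ffunP => i; rewrite ffunE; exact: h.
apply: fin_bigcap_measurable => // i _; exact: (measurable_preimage_iter i (mX (w i))).
Qed.

Lemma ent_blockS (F : finType) (X : T -> F) n : fmeas X ->
  ent mu (block g X n.+1) = ent mu (joint X (block g X n \o g)).
Proof.
move=> mX; have mB : fmeas (block g X n \o g).
  by move=> w; exact: (measurable_preimage_iter 1 (fmeas_block (n:=n) mX w)).
apply: ent_eq; first exact: fmeas_block.
- exact: fmeas_joint.
- move=> x y [eX /blockP eB]; apply/blockP => -[//|i] ni.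
  by rewrite !iterSr eB.
- move=> x y /blockP e; congr pair; first exact: (e 0%N).
  by apply/blockP => i ni; rewrite -!iterSr; exact: (e i.+1).
Qed.

Lemma ent_blockSr (F : finType) (X : T -> F) n : fmeas X ->
  ent mu (block g X n.+1) = ent mu (joint (block g X n) (X \o iter n g)).
Proof.
move=> mX; apply: ent_eq; first exact: fmeas_block.
- by apply: fmeas_joint; [exact: fmeas_block|exact: fmeas_iter].
- by move=> x y /blockSrP.
- by move=> x y /blockSrP.
Qed.

Lemma ent_block0 (F : finType) (X : T -> F) : fmeas X -> ent mu (block g X 0) = 0.
Proof.
move=> mX; have m0 := fmeas_block (n:=0) mX.
apply/eqP; rewrite eq_le ent_ge0 ?ent_const// => x y.
by apply/ffunP => -[].
Qed.

(** Each letter of the [X]-itinerary is compared with the letter of the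
    [Y]-itinerary at the same time; by invariance each comparison costs the
    same. *)
Lemma cent_block (F G : finType) (X : T -> F) (Y : T -> G) n :
  fmeas X -> fmeas Y ->
  cent mu (block g X n) (block g Y n) <= n%:R * cent mu X Y.
Proof.
move=> mX mY; elim: n => [|n IH].
  rewrite mul0r (le_trans (cent_le_ent _ _ _)) ?ent_block0//; exact: fmeas_block.
have mXn := fmeas_block (n:=n) mX; have mYn := fmeas_block (n:=n) mY.
have mXi := fmeas_iter n mX; have mYi := fmeas_iter n mY.
have mXS := fmeas_block (n:=n.+1) mX; have mYS := fmeas_block (n:=n.+1) mY.
have mXXi := fmeas_joint mXn mXi; have mYYi := fmeas_joint mYn mYi.
have -> : cent mu (block g X n.+1) (block g Y n.+1) =
    cent mu (joint (block g X n) (X \o iter n g)) (joint (block g Y n) (Y \o iter n g)).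
  congr (_ - _); last exact: ent_blockSr.
  apply: ent_eq; do ?exact: fmeas_joint.
    move=> x y exy; rewrite /joint (proj1 (blockSrP g X n x y) (congr1 fst exy)).
    by rewrite (proj1 (blockSrP g Y n x y) (congr1 snd exy)).
  move=> x y exy; have eX := proj2 (blockSrP g X n x y) (congr1 fst exy).
  have eY := proj2 (blockSrP g Y n x y) (congr1 snd exy).
  by rewrite /joint in eX eY *; rewrite eX eY.
apply: le_trans (cent_joint2 _ _ _ _ _) _ => //.
rewrite -[X in X%:R]addn1 natrD mulrDl mul1r lerD//.
have -> // : cent mu (X \o iter n g) (Y \o iter n g) = cent mu X Y.
congr (_ - _); last exact: ent_iter.
by rewrite -(ent_iter n (fmeas_joint mX mY)).
Qed.

Lemma ent_block_le (F G : finType) (X : T -> F) (Y : T -> G) n :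
  fmeas X -> fmeas Y ->
  ent mu (block g X n) <= ent mu (block g Y n) + n%:R * cent mu X Y.
Proof.
move=> mX mY.
have mXn := fmeas_block (n := n) mX; have mYn := fmeas_block (n := n) mY.
apply: le_trans (ent_le_cent _ mXn mYn) _.
by rewrite lerD2l cent_block.
Qed.

(** The increments are the conditional entropies of the present given the next
    [n] letters, which decrease as [n] grows. *)
Lemma ent_block_concave (F : finType) (X : T -> F) n : fmeas X ->
  ent mu (block g X n.+2) - ent mu (block g X n.+1) <=
  ent mu (block g X n.+1) - ent mu (block g X n).
Proof.
move=> mX.
have mB k : fmeas (block g X k \o g).
  by move=> w; exact: (measurable_preimage_iter 1 (fmeas_block (n:=k) mX w)).
have E k : ent mu (block g X k.+1) - ent mu (block g X k) = cent mu X (block g X k \o g).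
  by rewrite ent_blockS// -(ent_iter 1 (fmeas_block (n:=k) mX)).
rewrite !E; apply: cent_cond_le => // x y /blockP e; apply/blockP => i ni.
by rewrite e// ltnS ltnW.
Qed.

(** Concavity and the value 0 at 0 make the average per letter nonincreasing, so
    that the entropy rate exists and is the infimum of the averages. *)
Lemma ent_block_ratio (F : finType) (X : T -> F) n : fmeas X ->
  n%:R * ent mu (block g X n.+1) <= n.+1%:R * ent mu (block g X n).
Proof.
move=> mX; elim: n => [|n IH]; first by rewrite ent_block0// mul0r mulr0.
have := ent_block_concave n mX; rewrite -!natr1 in IH *.
set a := ent _ _ in IH *; set b := ent _ _ in IH *; set c := ent _ _ => h.
have : (n%:R + 1) * (c - a) <= (n%:R + 1) * (a - b).
  by rewrite ler_pM2l ?natr1// ltr0n.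
by lra.
Qed.

Definition entropy_rate (F : finType) (X : T -> F) : R :=
  lim (ent mu (block g X n) / n%:R @[n --> \oo]).

Lemma cvg_entropy_rate (F : finType) (X : T -> F) : fmeas X ->
  ent mu (block g X n) / n%:R @[n --> \oo] --> entropy_rate X /\
  forall n, (0 < n)%N -> n%:R * entropy_rate X <= ent mu (block g X n).
Proof.
move=> mX; pose u n := ent mu (block g X n) / n%:R.
have nd : nonincreasing_seq (fun n => u n.+1).
  apply/nonincreasing_seqP => n; rewrite /u ler_pdivrMr// mulrAC ler_pdivlMr//.
  by rewrite mulrC [leRHS]mulrC ent_block_ratio.
have lb : has_lbound (range (fun n => u n.+1)).
  exists 0 => _ [n _ <-]; rewrite divr_ge0// ent_ge0//; exact: fmeas_block.
have cu : cvgn (fun n => u n.+1) by exact: nonincreasing_is_cvgn.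
have ul : u n @[n --> \oo] --> limn (fun n => u n.+1).
  by rewrite -cvg_shiftS.
have le : entropy_rate X = limn (fun n => u n.+1) by apply/cvg_lim.
split; first by rewrite le.
move=> [//|n] _; rewrite le mulrC -ler_pdivlMr//.
exact: (nonincreasing_cvgn_ge nd cu).
Qed.

Lemma entropy_rate_le (F G : finType) (X : T -> F) (Y : T -> G) (e C : R) :
  fmeas X -> fmeas Y ->
  (forall n, ent mu (block g X n) <= ent mu (block g Y n) + n%:R * e + C) ->
  entropy_rate X <= entropy_rate Y + e.
Proof.
move=> mX mY h.
have [_ lX] := cvg_entropy_rate mX; have [cY _] := cvg_entropy_rate mY.
apply/ler_addgt0Pr => eps eps0.
have /cvgrPdist_lt /(_ (eps / 2)) := cY.
rewrite divr_gt0// => /(_ isT) [N _ hN].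
pose n := maxn N (Num.truncn (2 * C / eps)).+1.
have n0 : (0 < n)%N by rewrite /n leq_max orbT.
have := hN n (leq_maxl _ _).
rewrite /= ltr_distlC => /andP[_]; rewrite ltr_pdivrMr ?ltr0n// => hn.
have hC : C <= n%:R * (eps / 2).
  have : 2 * C / eps <= n%:R.
    by rewrite (le_trans (ltW (truncnS_gt _)))// ler_nat leq_maxr.
  by rewrite ler_pdivrMr//; lra.
have n0' : 0 < n%:R :> R by rewrite ltr0n.
rewrite -(ler_pM2l n0').
have := lX _ n0; have := h n.
by lra.
Qed.

Lemma entropy_rate_cent (F G : finType) (X : T -> F) (Y : T -> G) :
  fmeas X -> fmeas Y -> entropy_rate X <= entropy_rate Y + cent mu X Y.
Proof.
move=> mX mY; apply: (entropy_rate_le (C := 0)) => // n.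
by rewrite addr0; exact: ent_block_le.
Qed.

End Blocks.

(** * Counting itineraries on a set of monotonicity *)

(** The logarithm grows slower than any linear function; this absorbs polynomial
    counts of itineraries. *)
Lemma ln_affine {R : realType} (e : R) (N : nat) : 0 < e ->
  exists C, forall n, ln (n * N + 1)%:R <= n%:R * e + C.
Proof.
move=> e0; pose s := N.+1%:R / e; have s0 : 0 < s by rewrite divr_gt0.
exists (s^-1 + ln s) => n.
have y0 : 0 < (n * N + 1)%:R :> R by rewrite ltr0n addn1.
have := phi_tangent (ltW s0) y0; rewrite /phi => h.
have {h} : ln (n * N + 1)%:R <= ln s + (n * N + 1)%:R / s - 1.
  rewrite -(ler_pM2l s0) mulrBr mulrDr mulr1 mulrCA mulfV ?gt_eqF//.
  by rewrite mulr1; lra.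
move=> h; apply: (le_trans h).
rewrite natrD mulrDl mul1r natrM.
have : N%:R / s <= e.
  rewrite /s invf_div mulrA ler_pdivrMr// mulrC ler_pM2l// ler_nat//.
have : 0 <= n%:R :> R by [].
by move=> n0 /(ler_wpM2l n0); rewrite mulrA; lra.
Qed.

Section Counting.

(** A chain of subsets has at most one member of each cardinality. *)
Lemma chain_card (K : finType) (S : {set {ffun K -> bool}}) :
  {in S &, forall u v : {ffun K -> bool},
     (forall k, u k -> v k) \/ (forall k, v k -> u k)} ->
  (#|S| <= #|K| + 1)%N.
Proof.
move=> chain; pose c (u : {ffun K -> bool}) := [set k | u k]%SET.
have cK (u : {ffun K -> bool}) : (#|c u| < #|K| + 1)%N.
  by rewrite addn1 ltnS max_card.
pose h u : 'I_(#|K| + 1) := Ordinal (cK u).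
rewrite -[leqRHS]card_ord -(@card_in_imset _ _ h S) ?max_card//.
move=> u v uS vS /(congr1 val)/= ecard.
have sub (u' v' : {ffun K -> bool}) : #|c u'| = #|c v'| ->
    (forall k, u' k -> v' k) -> u' = v'.
  move=> e uv; have : c u' == c v'.
    by rewrite eqEcard e leqnn andbT; apply/fintype.subsetP => k; rewrite !inE => /uv.
  by move=> /eqP/finset.setP ce; apply/ffunP => k; have := ce k; rewrite !inE.
by have [uv|vu] := chain _ _ uS vS; [exact: sub|apply/esym; exact: sub].
Qed.

Context {R : realType}.
Implicit Types (E : set R) (g : R -> R).

(** The cell of [x] in the partition into intervals by the cut points [t] is
    recorded by its comparisons with them, because a comparison pulled back by a
    monotone map changes at most once. *)
Definition thr N (t : 'I_N -> R) (x : R) : {ffun 'I_N -> bool} :=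
  [ffun j => x <= t j].

Definition monotone_on E g :=
  (forall x y, E x -> E y -> x <= y -> g x <= g y) \/
  (forall x y, E x -> E y -> x <= y -> g y <= g x).

(** Along [E], the answer to each question [iter i g x <= t j] changes at most
    once. After negating the answers at the times where the iterate is
    decreasing, the itineraries of the points of [E] form a chain. In the
    application [E] consists of the points with a given itinerary through other
    cells, and may have many components. *)
Lemma card_thr_codes g E n N (t : 'I_N -> R) :
  (forall i, (i < n)%N -> monotone_on E (iter i g)) ->
  (#|[set w | `[< exists x, block g (thr t) n x = w /\ E x >]]%SET|
     <= n * N + 1)%N.
Proof.
move=> mono; set S := [set w | _]%SET.
have [s hs] : exists s : 'I_n -> bool, forall i x y, E x -> E y -> x <= y ->
    if s i then iter i g y <= iter i g x else iter i g x <= iter i g y.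
  suff /choice[s hs] : forall i : 'I_n, exists b : bool, forall x y, E x -> E y ->
      x <= y -> if b then iter i g y <= iter i g x else iter i g x <= iter i g y.
    by exists s.
  by move=> i; have [h|h] := mono i (ltn_ord i); [exists false|exists true].
pose c (w : {ffun 'I_n -> {ffun 'I_N -> bool}}) : {ffun 'I_n * 'I_N -> bool} :=
  [ffun k => w k.1 k.2 (+) s k.1].
have cI : injective c.
  move=> u v /ffunP e; apply/ffunP => i; apply/ffunP => j.
  by have := e (i, j); rewrite !ffunE/= => /addIb.
have -> : (n * N = #|{: 'I_n * 'I_N}|)%N by rewrite card_prod !card_ord.
rewrite -(card_imset S cI); apply: chain_card => _ _ /imsetP[u uS ->] /imsetP[v vS ->].
have [x [ux Ex]] : exists x, block g (thr t) n x = u /\ E x.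
  by move: uS; rewrite finset.inE => /asboolP.
have [y [vy Ey]] : exists x, block g (thr t) n x = v /\ E x.
  by move: vS; rewrite finset.inE => /asboolP.
rewrite -{}ux -{}vy {u uS v vS}.
have key x' y' : E x' -> E y' -> x' <= y' ->
    forall k, c (block g (thr t) n y') k -> c (block g (thr t) n x') k.
  move=> Ex' Ey' xy [i j]; rewrite !ffunE/= => h.
  have := hs i _ _ Ex' Ey' xy; move: h; case: (s i); rewrite ?addbT ?addbF.
    by move=> yt yx; apply: contra yt; exact: le_trans.
  by move=> yt xy'; exact: le_trans yt.
by have [xy|/ltW yx] := leP x y; [right|left]; apply: key.
Qed.

(** By induction: the points with itinerary [w] are sent by the [i]-th iterate
    into the single cell [w i], where the next application of [g] preserves or
    reverses their order. *)
Lemma monotone_iter (F : finType) (Q : R -> F) g (good : pred F) n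
    (w : {ffun 'I_n -> F}) :
  (forall u, good u -> monotone_on (Q @^-1` [set u]) g) ->
  (forall i, good (w i)) ->
  forall i, (i <= n)%N -> monotone_on (block g Q n @^-1` [set w]) (iter i g).
Proof.
move=> gmono gw; elim=> [|i IH] ni; first by left.
have ix x : (block g Q n @^-1` [set w]) x ->
    (Q @^-1` [set w (Ordinal ni)]) (iter i g x).
  by move=> /= <-; rewrite /preimage/= ffunE.
have [h|h] := IH (ltnW ni); have [gm|gm] := gmono _ (gw (Ordinal ni)).
- by left=> x y wx wy xy; apply: gm; [exact: ix..|exact: h].
- by right=> x y wx wy xy; apply: gm; [exact: ix..|exact: h].
- by right=> x y wx wy xy; apply: gm; [exact: ix..|exact: h].
- by left=> x y wx wy xy; apply: gm; [exact: ix..|exact: h].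
Qed.

End Counting.

(** * Partitions are approximated by cut points *)

Lemma mass_vanish {R : realType} d (T : measurableType d)
    (mu : probability T R) (F : (set T)^nat) (e : R) :
  (forall i, measurable (F i)) ->
  (forall i j, (i <= j)%N -> F j `<=` F i) ->
  mu (\bigcap_i F i) = 0%E -> 0 < e -> exists n, mass mu (F n) < e.
Proof.
move=> mF dF F0 e0.
have mI : measurable (\bigcap_i F i) by exact: bigcapT_measurable.
have fin0 : (mu (F 0%N) < +oo)%E.
  by rewrite (le_lt_trans (probability_le1 mu (mF 0%N)))// ltry.
have nd : {homo F : n m / (n <= m)%N >-> (m <= n)%O}.
  by move=> i j ij; apply/subsetPset/dF.
have : mu (F n) @[n --> \oo] --> mu (\bigcap_i F i).
  exact: nonincreasing_cvg_mu.
rewrite F0 => /fine_cvgP[].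
move=> _ /cvgrPdist_lt /(_ _ e0)[n _ /(_ n (leqnn n))].
by rewrite /= sub0r normrN ger0_norm ?mass_ge0//; exists n.
Qed.

Section Approximation.
Context {R : realType} (mu : probability (measurableTypeR R) R).
Local Notation T := (measurableTypeR R).

Lemma fmeas_thr N (t : 'I_N -> R) : fmeas (T := T) (thr t).
Proof.
move=> w; have -> : thr t @^-1` [set w] =
    \bigcap_(j in [set: 'I_N]) (if w j then `]-oo, t j]%classic else `]t j, +oo[%classic).
  apply/seteqP; split => x /=.
    move=> <- j _; rewrite /thr ffunE; case: ifP; rewrite /= in_itv/= ?andbT//.
    by rewrite leNgt => /negbFE.
  move=> h; apply/ffunP => j; have := h j I; rewrite ffunE.
  by case: (w j); rewrite /= in_itv/= ?andbT// ltNge => /negbTE.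
by apply: fin_bigcap_measurable => // j _; case: ifP.
Qed.

Definition isin (A : set T) (x : T) : bool := `[< A x >].

Lemma fmeas_isin A : measurable A -> fmeas (isin A).
Proof.
move=> mA [|]; rewrite /isin.
  rewrite (_ : _ @^-1` _ = A)//; apply/seteqP.
  by split=> x /=; rewrite -/(is_true _); [move/asboolP|move=> /asboolP].
rewrite (_ : _ @^-1` _ = ~` A); first exact: measurableC.
apply/seteqP; split=> x /= => [/negbT/asboolPn//|nA].
by rewrite asboolF.
Qed.

(** As [s] is free, this makes the entropy of a set tend to 0 with its mass. *)
Lemma ent_isin_le A s : measurable A -> 0 < s ->
  ent mu (isin A) <= s - mass mu A * ln s.
Proof.
move=> mA s0; have mi := fmeas_isin mA.
have lt : law mu (isin A) true = mass mu A.
  congr mass; apply/seteqP.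
  by split=> x /=; rewrite /isin -/(is_true _); [move/asboolP|move=> /asboolP].
have := sum_law mu mi; rewrite /ent !big_bool/= lt => h.
have := phi_tangent (mass_ge0 mu A) s0.
have := phi_tangent (law_ge0 mu (isin A) false) ltr01.
by rewrite ln1; lra.
Qed.

(** Entropy is defined through arbitrary measurable partitions, while itineraries
    can be counted only for partitions into intervals. The variables that are
    recovered from cut points up to small conditional entropy turn out to be all
    of them. *)
Definition approximable (F : finType) (X : T -> F) := fmeas X /\
  forall e : R, 0 < e -> exists N (t : 'I_N -> R), cent mu X (thr t) <= e.

Lemma approximable_joint (F G : finType) (X : T -> F) (Y : T -> G) :
  approximable X -> approximable Y -> approximable (joint X Y).
Proof.
move=> [mX aX] [mY aY]; split; first exact: fmeas_joint.
move=> e e0; have e20 : 0 < e / 2 by rewrite divr_gt0.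
have [N1 [t1 h1]] := aX _ e20; have [N2 [t2 h2]] := aY _ e20.
pose t (k : 'I_(N1 + N2)) := match fintype.split k with inl i => t1 i | inr j => t2 j end.
have d1 : determined (thr t1) (thr t).
  move=> x y /ffunP h; apply/ffunP => j; have := h (unsplit (inl j)).
  by rewrite !ffunE /t unsplitK.
have d2 : determined (thr t2) (thr t).
  move=> x y /ffunP h; apply/ffunP => j; have := h (unsplit (inr j)).
  by rewrite !ffunE /t unsplitK.
exists (N1 + N2)%N, t.
apply: le_trans (cent_joint mu mX mY (fmeas_thr t)) _.
have := cent_cond_le mu mX (fmeas_thr t1) (fmeas_thr t) d1.
have := cent_cond_le mu mY (fmeas_thr t2) (fmeas_thr t) d2.
by lra.
Qed.

Lemma approximable_det (F G : finType) (X : T -> F) (Y : T -> G) :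
  fmeas X -> approximable Y -> determined X Y -> approximable X.
Proof.
move=> mX [mY aY] XY; split=> // e e0; have [N [t h]] := aY _ e0.
exists N, t; apply: le_trans h; apply: cent_le => //; first exact: fmeas_thr.
by move=> x y []/XY.
Qed.

Lemma approximable_const (F : finType) (X : T -> F) :
  fmeas X -> (forall x y, X x = X y) -> approximable X.
Proof.
move=> mX cX; split=> // e e0; exists 0%N, (fun=> 0).
rewrite (le_trans (cent_le_ent mu mX (fmeas_thr _)))//.
by rewrite (le_trans (ent_const mu mX cX))// ltW.
Qed.

(** A countable union differs from a finite one by a set of small mass, which has
    small entropy. This is the step that makes the approximable sets a
    sigma-algebra. *)
Lemma approximable_bigcup (A : (set T)^nat) :
  (forall i, measurable (A i) /\ approximable (isin (A i))) ->
  approximable (isin (\bigcup_i A i)).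
Proof.
move=> hA; pose B n := \big[setU/set0]_(i < n) A i.
have mB n : measurable (B n) by apply: bigsetU_measurable => i _; case: (hA i).
have aB n : approximable (isin (B n)).
  elim: n => [|n IH].
    apply: approximable_const; first exact: fmeas_isin.
    by move=> x y; rewrite /isin /B big_ord0 !asboolF.
  have [mAn aAn] := hA n.
  apply: (approximable_det _ (approximable_joint IH aAn)).
    exact: fmeas_isin.
  move=> x y []; rewrite /isin => eB eA; rewrite /B big_ord_recr/=.
  by rewrite !asbool_or eB eA.
have mU : measurable (\bigcup_i A i) by apply: bigcup_measurable => i _; case: (hA i).
split=> [|e e0]; first exact: fmeas_isin.
pose s := e / 4; have s0 : 0 < s by rewrite divr_gt0.
have [n hn] : exists n, mass mu ((\bigcup_i A i) `\` B n) * `|ln s| <= s.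
  have D0 : \bigcap_n ((\bigcup_i A i) `\` B n) = set0.
    rewrite -subset0 => x Dx; have [[i _ Ax] _] := Dx 0%N I.
    have [_] := Dx i.+1 I; apply.
    by rewrite /B -bigcup_mkord; exists i => //=.
  have q0 : 0 < s / (`|ln s| + 1) by rewrite divr_gt0// ltr_wpDl.
  have [|||n] := mass_vanish _ _ _ q0 (F := fun n => (\bigcup_i A i) `\` B n) (mu := mu).
  - by move=> i; exact: measurableD.
  - move=> i j ij; apply: setDS; rewrite /B -!bigcup_mkord.
    by apply: bigcup_subset => k /= ki; exact: leq_trans ij.
  - by rewrite D0 measure0.
  rewrite ltr_pdivlMr ?ltr_wpDl// => hn; exists n.
  rewrite (le_trans _ (ltW hn))// ler_wpM2l ?mass_ge0//; lra.
have e20 : 0 < e / 2 by rewrite divr_gt0.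
have [N [t h]] := (aB n).2 _ e20.
exists N, t.
apply: le_trans (cent_triangle mu (fmeas_isin mU) (fmeas_isin (mB n)) (fmeas_thr t)) _.
have mD : measurable ((\bigcup_i A i) `\` B n) by exact: measurableD.
suff : cent mu (isin (\bigcup_i A i)) (isin (B n)) <= e / 2 by lra.
apply: (@le_trans _ _ (cent mu (isin ((\bigcup_i A i) `\` B n)) (isin (B n)))).
  apply: cent_le; [exact: fmeas_isin..|].
  move=> x y []; rewrite /isin !asbool_and !asbool_neg => eD eB.
  have BU z : `[< B n z >] -> `[< (\bigcup_i A i) z >].
    move=> /asboolP; rewrite /B -bigcup_mkord => -[i _ Az].
    by apply/asboolP; exists i.
  move: eD; rewrite -eB; have := BU x; have := BU y; rewrite -eB.
  by case: asbool => /=; rewrite ?andbF ?andbT// => -> // ->.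
apply: le_trans (cent_le_ent mu (fmeas_isin mD) (fmeas_isin (mB n))) _.
apply: le_trans (ent_isin_le mD s0) _.
have : - (mass mu ((\bigcup_i A i) `\` B n) * ln s) <=
    mass mu ((\bigcup_i A i) `\` B n) * `|ln s|.
  rewrite -mulrN ler_wpM2l ?mass_ge0// -normrN; exact: ler_norm.
by rewrite /s in hn *; lra.
Qed.

Lemma approximable_isin (A : set T) : measurable A -> approximable (isin A).
Proof.
suff : (@measurable _ T) `<=` [set A | measurable A /\ approximable (isin A)].
  by move=> h /h[].
move=> {A}; apply: smallest_sub; last first.
  move=> _ [[u v] _ <-]; have mx : measurable (`]u, v]%classic : set T) by [].
  split=> //; split; first exact: fmeas_isin.
  move=> e e0; pose t (j : 'I_2) := if j == ord0 then u else v.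
  exists 2%N, t.
  have tx : determined (isin (`]u, v]%classic : set T)) (thr t).
    move=> y z /ffunP eyz; have := eyz ord0; have := eyz ord_max.
    by rewrite !ffunE /isin /= !in_itv/= !asboolb !ltNge /t/= => -> ->.
  apply: le_trans (ltW e0); rewrite subr_le0.
  apply: ent_le; first exact: fmeas_thr.
  by move=> y z eyz; rewrite /joint eyz (tx _ _ eyz).
split.
- split=> //; apply: approximable_const; first exact: fmeas_isin.
  by move=> x y; rewrite /isin !asboolF.
- move=> A [mA aA]; have mCA : measurable (setT `\` A : set T).
    exact: measurableD.
  split=> //; apply: (approximable_det (fmeas_isin mCA) aA).
  by rewrite setTD => x y; rewrite /isin !asbool_neg => ->.
- move=> A hA; split; last exact: approximable_bigcup.
  by apply: bigcup_measurable => i _; case: (hA i).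
Qed.

Lemma approximable_fmeas (F : finType) (X : T -> F) : fmeas X -> approximable X.
Proof.
move=> mX; pose Y (s : seq F) x := [ffun u => (u \in s) && (X x == u)].
have mY s : fmeas (Y s) by exact: (fmeas_comp (fun v => [ffun u => (u \in s) && (v == u)]) mX).
have aY s : approximable (Y s).
  elim: s => [|u s IH].
    by apply: approximable_const => // x y; apply/ffunP => v; rewrite !ffunE.
  apply: (approximable_det _ (approximable_joint IH (approximable_isin (mX u)))) => //.
  move=> x y [/ffunP e1 e2]; apply/ffunP => v; have := e1 v; rewrite !ffunE !inE.
  have [-> _|//] := eqVneq v u.
  by move: e2; rewrite /isin /preimage/= -!eq_opE !asboolb => ->.
apply: (approximable_det mX (aY (enum F))) => x y /ffunP/(_ (X x)).
by rewrite !ffunE !mem_enum eqxx/= => /esym/eqP.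
Qed.

End Approximation.

(** * One-variable calculus on a compact interval *)

Section Derivative.
Context {R : realType}.
Implicit Types (f : R -> R) (x y a b : R).

Lemma derivable_in_dist (I : set R) f x (e : R) : derivable_in I f x -> 0 < e ->
  exists2 d : R, 0 < d & forall y, I y -> y != x -> `|x - y| < d ->
    `|deriv_in I f x - (f y - f x) / (y - x)| < e.
Proof.
move=> df e0; have /cvgrPdist_lt/(_ _ e0) :
   (f y - f x) / (y - x) @[y --> within I x^'] --> deriv_in I f x by [].
move=> /nbhs_ballP[d /= d0 hd]; exists d => // y Iy yx xy.
exact: hd.
Qed.

Lemma derivable_in_continuous a b f :
  (forall x, x \in `[a, b] -> derivable_in `[a, b]%classic f x) ->
  {within `[a, b], continuous f}.
Proof.
move=> df; apply/subspace_continuousP => x xI; apply/cvgrPdist_lt => e e0.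
have [d d0 hd] := derivable_in_dist (df _ xI) ltr01.
pose K := `|deriv_in `[a, b]%classic f x| + 1.
have K0 : 0 < K by rewrite ltr_wpDl.
have : 0 < Num.min d (e / K) by rewrite lt_min d0 divr_gt0.
set d' := Num.min _ _ => d'0.
apply/nbhs_ballP; exists d' => //= y; rewrite /ball/= => xy yI.
have [->|yx] := eqVneq y x; first by rewrite subrr normr0.
have yx0 : 0 < `|y - x| by rewrite normr_gt0 subr_eq0.
have := hd y yI yx; move: xy; rewrite lt_min => /andP[xyd xyK] /(_ xyd) h.
have : `|(f y - f x) / (y - x)| < K.
  have := ler_normB (deriv_in `[a, b]%classic f x)
    (deriv_in `[a, b]%classic f x - (f y - f x) / (y - x)).
  by rewrite opprB addrC subrK /K; move: h; lra.
rewrite normrM normfV ltr_pdivrMr// distrC => h2.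
apply: (lt_trans h2); rewrite [`|y - x|]distrC.
by rewrite mulrC -ltr_pdivlMr.
Qed.

Lemma is_derive_deriv_in a b f x : x \in `]a, b[ ->
  derivable_in `[a, b]%classic f x -> is_derive x 1 f (deriv_in `[a, b]%classic f x).
Proof.
move=> xab df.
suff h : (fun h => h^-1 *: ((f \o shift x) (h *: (1:R)) - f x)) @ 0^' -->
    deriv_in `[a, b]%classic f x.
  apply: DeriveDef; first by apply/cvg_ex; eexists; exact: h.
  by apply/cvg_lim.
apply/cvgrPdist_lt => e e0; have [d d0 hd] := derivable_in_dist df e0.
move: xab; rewrite in_itv/= => /andP[ax xb].
have : 0 < Num.min d (Num.min (x - a) (b - x)) by rewrite !lt_min d0 !subr_gt0 ax.
set d' := Num.min _ _ => d'0.
apply/nbhs_ballP; exists d' => //= y; rewrite /ball/= sub0r normrN => yd' y0.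
move: yd'; rewrite !lt_min => /andP[yd /andP[yxa ybx]].
rewrite /= [_ *: 1]mulr1 -[_ *: _]/(_ * _) mulrC.
have {2}-> : y = (y + x) - x by rewrite addrK.
apply: hd => /=.
- rewrite in_itv/=; have := ler_norm y; have := ler_norm (- y); rewrite normrN.
  by move: yxa ybx; lra.
- by rewrite -subr_eq0 addrK.
- by rewrite opprD addrCA subrr addr0 normrN.
Qed.

Lemma MVT_in a b f x y :
  (forall x, x \in `[a, b] -> derivable_in `[a, b]%classic f x) ->
  x \in `[a, b] -> y \in `[a, b] -> x < y ->
  exists2 c, x < c < y & f y - f x = deriv_in `[a, b]%classic f c * (y - x).
Proof.
move=> df; rewrite !in_itv/= => /andP[ax xb] /andP[ay yb] xy.
have [|||c cxy e] := @MVT R f (deriv_in `[a, b]%classic f) x y => //.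
- move=> z; rewrite in_itv/= => /andP[xz zy]; apply: is_derive_deriv_in.
    by rewrite in_itv/=; apply/andP; split; lra.
  by apply: df; rewrite in_itv/=; apply/andP; split; lra.
- apply: continuous_subspaceW (derivable_in_continuous df).
  by apply: subset_itv; rewrite bnd_simp.
- by exists c => //; move: cxy; rewrite in_itv.
Qed.

(** The hypothesis keeps the derivative of the sign that it has at [x0] on the
    convex hull of [E], so that the mean value theorem applies between any two
    points of [E]. *)
Lemma monotone_of_deriv a b f (E : set R) x0 :
  (forall x, x \in `[a, b] -> derivable_in `[a, b]%classic f x) ->
  E `<=` `[a, b]%classic -> 
  (forall x y z, E x -> E y -> x < z < y ->
    `|deriv_in `[a, b]%classic f x0 - deriv_in `[a, b]%classic f z| <
     `|deriv_in `[a, b]%classic f x0|) ->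
  monotone_on E f.
Proof.
move=> df EI osc; set h := deriv_in _ f in osc *.
have [h0|h0] := leP 0 (h x0); [left|right] => x y Ex Ey; rewrite le_eqVlt;
  move=> /predU1P[->//|xy];
  have [c xcy e] := MVT_in df (EI _ Ex) (EI _ Ey) xy;
  have := osc _ _ _ Ex Ey xcy; rewrite -subr_ge0 -/h in e *.
- rewrite e (ger0_norm h0) => o; rewrite mulr_ge0//; last by rewrite subr_ge0 ltW.
  by have := ler_norm (h x0 - h c); lra.
- rewrite -[f x - f y]opprB e (ltr0_norm h0) => o.
  rewrite oppr_ge0 mulr_le0_ge0//; last by rewrite subr_ge0 ltW.
  by have := ler_norm (- (h x0 - h c)); rewrite normrN; lra.
Qed.

Definition hoelder_on (I : set R) (h : R -> R) := exists C alpha : R,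
  [/\ 0 < C, 0 < alpha & forall x y, I x -> I y ->
     `|h x - h y| <= C * `|x - y| `^ alpha].

(** If [r < 2] the Hoelder bound on [f'] is a hypothesis. Otherwise [f'] is
    Lipschitz, as [f''] is bounded on the compact interval. *)
Lemma smooth_in_deriv a b f r : a < b -> 1 < r -> smooth_in `[a, b]%classic r f ->
  [/\ forall x, x \in `[a, b] -> derivable_in `[a, b]%classic f x,
     {within `[a, b], continuous (deriv_in `[a, b]%classic f)} &
     hoelder_on `[a, b]%classic (deriv_in `[a, b]%classic f)].
Proof.
move=> ab r1 [[]]; set I := `[a, b]%classic; set k := Num.truncn r.
have k1 : (0 < k)%N by rewrite truncn_gt0 ltW.
move=> dk ck [C hC].
have df x : x \in `[a, b] -> derivable_in I f x by move=> xI; exact: (dk 0%N x).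
have [k1' | k2] : k = 1%N \/ (1 < k)%N.
  by move: k1; rewrite leq_eqVlt => /predU1P[<-|]; [left|right].
  split=> //; first by move: ck; rewrite k1'.
  exists (Num.max C 1), (r - 1); split.
  - by rewrite lt_max ltr01 orbT.
  - by rewrite subr_gt0.
  - move=> x y Ix Iy; have := hC x y Ix Iy; rewrite k1' => h.
    by rewrite (le_trans h)// ler_wpM2r ?powR_ge0// le_max lexx.
have df' x : x \in `[a, b] -> derivable_in I (deriv_in I f) x.
  by move=> xI; exact: (dk 1%N x).
split=> //; first exact: derivable_in_continuous.
have cf'' : {within I, continuous (derivn_in I 2 f)}.
  move: k2; rewrite leq_eqVlt => /predU1P[->//|k3].
  apply: derivable_in_continuous => x xI; exact: (dk 2%N x).
have cn : {within I, continuous (fun x => `|derivn_in I 2 f x|)}.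
  move=> x; apply: continuous_comp; [exact: cf''|exact: norm_continuous].
have [c _ hc] := EVT_max (ltW ab) cn.
exists (`|derivn_in I 2 f c| + 1), 1; split=> //.
have key x y : x \in `[a, b] -> y \in `[a, b] -> x < y ->
   `|deriv_in I f x - deriv_in I f y| <= (`|derivn_in I 2 f c| + 1) * (y - x).
  move=> xI yI xy; have [z zxy e] := MVT_in df' xI yI xy.
  rewrite distrC e normrM [`|y - x|]gtr0_norm ?subr_gt0//.
  rewrite ler_wpM2r ?subr_ge0 ?ltW//.
  have zI : z \in `[a, b].
    move: xI yI zxy; rewrite !in_itv/= => /andP[? ?] /andP[? ?] /andP[? ?].
    by apply/andP; split; lra.
  by have := hc _ zI; rewrite /derivn_in/=; lra.
move=> x y xI yI; rewrite powRr1//.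
have [xy|yx|->] := ltgtP x y.
- by rewrite (ltr0_norm (x := x - y)) ?subr_lt0// opprB; exact: key.
- by rewrite distrC (gtr0_norm (x := x - y)) ?subr_gt0//; exact: key.
- by rewrite !subrr normr0 mulr0.
Qed.

(** This is where smoothness beyond C^1 enters: the scale [d] at which the
    derivative oscillates by less than [expR (- k.+1)] decreases no faster than
    exponentially in [k]. For a map that is merely C^1 the number [L / d] of
    pieces of this size could grow arbitrarily fast. *)
Lemma hoelder_resolution (I : set R) (h : R -> R) (L : R) :
  0 <= L -> hoelder_on I h ->
  exists A gamma : R, [/\ 1 <= A, 0 <= gamma & forall k : nat, exists2 d : R, 0 < d &
    (forall x y, I x -> I y -> `|x - y| <= d ->
       `|h x - h y| < expR (- (k.+1)%:R)) /\
    L / d + 1 <= A * expR (gamma * k%:R)].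
Proof.
move=> L0 [C [al [C0 al0 hC]]].
pose gamma := al^-1; have g0 : 0 < gamma by rewrite invr_gt0.
pose A := L * expR (gamma * (1 + ln (2 * C))) + 1.
exists A, gamma; split; first by rewrite lerDr mulr_ge0// expR_ge0.
  exact: ltW.
move=> k; pose d := expR (- (gamma * ((k.+1)%:R + ln (2 * C)))).
have d0 : 0 < d by exact: expR_gt0.
exists d => //; split.
  move=> x y Ix Iy xy; apply: le_lt_trans (hC _ _ Ix Iy) _.
  have : `|x - y| `^ al <= d `^ al by rewrite ge0_ler_powR// ?nnegrE ?ltW.
  move=> h1; apply: (@le_lt_trans _ _ (C * d `^ al)); first by rewrite ler_pM2l.
  rewrite /powR gt_eqF// /d expRK mulrN mulrA mulfV ?gt_eqF// mul1r opprD expRD.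
  have C2 : 0 < 2 * C by rewrite mulr_gt0.
  rewrite [expR (- ln _)]expRN lnK// mulrCA.
  rewrite gtr_pMr ?expR_gt0// ltr_pdivrMr// mul1r.
  by rewrite ltr_pMl// ltr1n.
rewrite /d expRN invrK mulrDr -natr1 mulrDr mulr1 -addrA [X in expR X]addrC expRD.
rewrite (_ : gamma + _ = gamma * (1 + ln (2 * C))); last by ring.
rewrite /A [leRHS]mulrDl mul1r mulrA; apply: lerD => //.
by rewrite -[leLHS]expR0 ler_expR mulr_ge0// ltW.
Qed.

End Derivative.

(** * Labels near the critical set and their entropy *)

Section Moments.
Context {R : realType} (mu : probability (measurableTypeR R) R).
Local Notation T := (measurableTypeR R).
Context (w : T -> R) (V : set T) (eta : R).
Context (mw : measurable_fun setT w) (mV : measurable V)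
  (wV : forall x, V x -> 0 <= w x <= expR (-1))
  (integral_le : (`| \int[mu]_(x in V) lne (w x)%:E | <= eta%:E)%E).

Lemma measurable_lne_fun : measurable_fun setT (fun x => lne (w x)%:E).
Proof.
apply: (measurable_fun_ifT (f := fun x => w x <= 0)
  (g := fun=> -oo%E) (h := fun x => (ln (w x))%:E)) => //.
- exact: measurable_fun_ler.
- by apply/measurable_EFinP; apply: measurableT_comp => //; exact: measurable_ln.
Qed.

(** Any function of a variable that is dominated by [- ln w] on [V] and vanishes
    off [V] has mean at most [eta]. This is how the hypothesis on the integral
    of log|f'| enters. *)
Lemma moment_le (F : finType) (Y : T -> F) (c : F -> R) : fmeas Y ->
  (forall u, 0 <= c u) -> (forall x, ~ V x -> c (Y x) = 0) ->
  (forall x, V x -> 0 < w x -> c (Y x) <= - ln (w x)) ->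
  \sum_u c u * law mu Y u <= eta.
Proof.
move=> mY c0 cV cw.
have lne0 x : V x -> (0 <= - lne (w x)%:E)%E.
  move=> /wV/andP[w0 w1]; rewrite oppe_ge0 lne_le0 lee_fin (le_trans w1)//.
have : (\int[mu]_(x in V) (- lne (w x)%:E) <= eta%:E)%E.
  apply: le_trans integral_le.
  have -> : (\int[mu]_(x in V) lne (w x)%:E = - \int[mu]_(x in V) (- lne (w x)%:E))%E.
    by rewrite -integral_ge0N//; apply: eq_integral => x _; rewrite oppeK.
  by rewrite abseN; exact: lee_abs.
move=> le_eta; rewrite -lee_fin; apply: le_trans le_eta.
have ind0 u x : 0 <= c u * \1_(Y @^-1` [set u]) x by rewrite mulr_ge0.
have -> : (\sum_u c u * law mu Y u)%:E = 
   (\int[mu]_(x in V) (\sum_u (c u * \1_(Y @^-1` [set u]) x)%:E))%E.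
  rewrite ge0_integral_sum//; last 2 first.
  - move=> u; apply/measurable_EFinP/measurable_funM => //.
  - by move=> u x _; rewrite lee_fin.
  rewrite -sumEFin; apply: eq_bigr => u _.
  rewrite (integralZl_indic mV (fun=> Y @^-1` [set u]))//; last first.
    by move=> /lt_geF; rewrite c0.
  rewrite integral_indic// EFinM; have [->|cu] := eqVneq (c u) 0.
    by rewrite !mul0e.
  congr (_ * _)%E; rewrite -massE; last exact: mY.
  rewrite setIidl// => x /= Yx; apply: contrapT => /cV.
  by rewrite Yx => /eqP; rewrite (negbTE cu).
apply: ge0_le_integral => //.
- by move=> x _; apply: sume_ge0 => u _; rewrite lee_fin.
- apply: emeasurable_sum => u; apply/measurable_EFinP/measurable_funM => //.
- by apply: measurableT_comp => //; apply: measurable_funTS; exact: measurable_lne_fun.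
- move=> x Vx; rewrite sumEFin (bigD1 (Y x))//= big1 => [|u uY].
    rewrite addr0 indicE mem_set// mulr1.
    have /andP[w0 _] := wV Vx; move: w0; rewrite le_eqVlt => /predU1P[<-|w0].
      by rewrite /lne/= lexx leey.
    by rewrite (leNgt (w x)) w0/= lee_fin cw.
  by rewrite indicE memNset ?mulr0//= => e; rewrite e eqxx in uY.
Qed.

End Moments.

Section LabelMeasurability.
Context {R : realType} d (T : measurableType d).

Lemma fmeas_bool (b : T -> bool) : measurable (b @^-1` [set true]) -> fmeas b.
Proof.
move=> mb [//|]; rewrite (_ : _ @^-1` _ = ~` (b @^-1` [set true])).
  exact: measurableC.
by apply/seteqP; split=> x /=; case: (b x).
Qed.

Lemma fmeas_ffun (I F : finType) (X : I -> T -> F) : (forall i, fmeas (X i)) ->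
  fmeas (fun x => [ffun i => X i x]).
Proof.
move=> mX v; have -> : (fun x => [ffun i => X i x]) @^-1` [set v] =
    \bigcap_(i in [set: I]) (X i @^-1` [set v i]).
  apply/seteqP; split => x /=; first by move=> <- i _; rewrite /= ffunE.
  by move=> h; apply/ffunP => i; rewrite ffunE; exact: h.
by apply: fin_bigcap_measurable => // i _; exact: mX.
Qed.

Lemma fmeas_inord_truncn (u : T -> R) n : measurable_fun setT u ->
  fmeas (fun x => inord (Num.truncn (u x)) : 'I_n.+1).
Proof.
move=> mu i.
have mge k : measurable [set x | (k <= Num.truncn (u x))%N].
  case: k => [|k].
    by rewrite (_ : [set x | _] = setT)//; apply/seteqP; split.
  rewrite (_ : [set x | _] = u @^-1` `[k.+1%:R, +oo[).
    by rewrite -[X in measurable X]setTI; exact: mu.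
  by apply/seteqP; split=> x /=; rewrite in_itv/= andbT truncn_gt_nat.
rewrite (_ : _ @^-1` _ = \bigcup_(k in [set k | inord k = i])
    ([set x | (k <= Num.truncn (u x))%N] `\` [set x | (k.+1 <= Num.truncn (u x))%N])).
  by apply: bigcup_measurable => k _; apply: measurableD.
apply/seteqP; split=> x /=.
  by move=> e; exists (Num.truncn (u x)) => //=; split=> //; rewrite ltnn.
move=> [k /= ki [h1 h2]]; rewrite -ki; congr inord; apply/eqP.
rewrite eqn_leq h1 leqNgt andbT; exact/negP.
Qed.

End LabelMeasurability.

Section Label.
Context {R : realType} (w : R -> R) (V : set R) (a b : R) (d : nat -> R).
Local Notation T := (measurableTypeR R).

(** In the application [w] is |f'|, so that the derivative at a point of level
    [k] exceeds [expR (- k.+1)], and [d k] is the scale at which the derivative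
    oscillates by less than that. *)
Definition level x := Num.truncn (- ln (w x)).

Definition piece k x := Num.truncn ((x - a) / d k).

Definition pieces k := (Num.truncn ((b - a) / d k)).+1.

(** [None] marks the complement of [V], and [Some None] the points of [V]
    where [w] is below [expR (- K)], such as the critical points. Other points
    of [V] are labelled by their level and their position in the grid of mesh [d k]. The
    bound [B] only serves to have a finite type. *)
Definition label K B (x : R) : option (option ('I_K.+1 * 'I_B.+1)) :=
  if `[< V x >] then
    if expR (- K%:R) <= w x then
      let k : 'I_K.+1 := inord (level x) in Some (Some (k, inord (piece k x)))
    else Some None
  else None.

Context (mw : measurable_fun setT (w : T -> R)) (mV : measurable (V : set T)).

Lemma fmeas_label K B : fmeas (T := T) (label K B).
Proof.
pose Z x : bool * bool * 'I_K.+1 * {ffun 'I_K.+1 -> 'I_B.+1} :=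
  (`[< V x >], expR (- K%:R) <= w x, inord (level x),
    [ffun k : 'I_K.+1 => inord (piece k x)]).
pose g (z : bool * bool * 'I_K.+1 * {ffun 'I_K.+1 -> 'I_B.+1}) :
     option (option ('I_K.+1 * 'I_B.+1)) :=
  if z.1.1.1 then if z.1.1.2 then Some (Some (z.1.2, z.2 z.1.2)) else Some None
  else None.
have -> : label K B = g \o Z.
  apply/funext => x; rewrite /label /g /=.
  by case: ifP => // _; case: ifP => // _; rewrite ffunE.
apply: fmeas_comp; apply: (@fmeas_joint _ T).
  apply: (@fmeas_joint _ T); first apply: (@fmeas_joint _ T).
- exact: fmeas_isin.
- apply: fmeas_bool; have := measurable_fun_ler (measurable_cst (expR (- K%:R))) mw.
  by move=> /(_ measurableT [set true]); rewrite setTI; exact.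
- apply: fmeas_inord_truncn; apply: measurableT_comp => //.
  by apply: measurableT_comp => //; exact: measurable_ln.
- apply: fmeas_ffun => k; apply: fmeas_inord_truncn.
  by apply: measurable_funM => //; apply: measurable_funB.
Qed.

Context (VI : V `<=` `[a, b]%classic) (d0 : forall k, 0 < d k).

Lemma piece_lt k x : V x -> (piece k x < pieces k)%N.
Proof.
move=> /VI; rewrite /= in_itv/= ltnS => /andP[ax xb].
by apply: le_truncn; rewrite ler_pM2r ?invr_gt0// lerD2r.
Qed.

Lemma level_le K x : expR (- K%:R) <= w x -> (level x <= K)%N.
Proof.
move=> wK; rewrite /level truncn_le_nat.
have w0 : 0 < w x by apply: lt_le_trans wK; exact: expR_gt0.
have : - K%:R <= ln (w x) by rewrite -[leLHS]expRK ler_ln ?posrE// expR_gt0.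
by rewrite -natr1; lra.
Qed.

Lemma expR_level_lt x : 0 < w x -> expR (- (level x).+1%:R) < w x.
Proof.
move=> w0; rewrite -[ltRHS]lnK ?posrE// ltr_expR.
by have := truncnS_gt (- ln (w x)); rewrite /level; lra.
Qed.

Lemma level_le_ln x : w x <= 1 -> (level x)%:R <= - ln (w x).
Proof.
by move=> w1; have /truncn_itv/andP[] : 0 <= - ln (w x) by rewrite oppr_ge0 ln_le0.
Qed.

Lemma labelP K B x : (forall k, (k <= K)%N -> (pieces k <= B.+1)%N) ->
  match label K B x with
  | None => ~ V x
  | Some None => V x /\ w x < expR (- K%:R)
  | Some (Some (k, i)) => [/\ V x, expR (- K%:R) <= w x, k = level x :> nat,
       i = piece k x :> nat & (i < pieces k)%N]
  end.
Proof.
move=> hB; rewrite /label; case: ifPn => [/asboolP Vx|/asboolPn//].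
case: ifPn => [wK|]; last by rewrite -ltNge.
have lK := level_le wK; have pl := piece_lt (level x) Vx.
have k_ : nat_of_ord (@inord K (level x)) = level x by rewrite inordK.
have i_ : nat_of_ord (@inord B (piece (level x) x)) = piece (level x) x.
  by rewrite inordK// (leq_trans pl)// hB.
by rewrite /= k_ i_.
Qed.

Lemma label_close K B x y k i : (forall k, (k <= K)%N -> (pieces k <= B.+1)%N) ->
  label K B x = Some (Some (k, i)) -> label K B y = Some (Some (k, i)) ->
  `|x - y| <= d k.
Proof.
move=> hB lx ly.
have := labelP x hB; rewrite lx => -[/VI + _ _ ix _].
have := labelP y hB; rewrite ly => -[/VI + _ _ iy _].
rewrite /= !in_itv/= => /andP[ay yb] /andP[ax xb].
have nn z : a <= z -> 0 <= (z - a) / d k by move=> az; rewrite divr_ge0 ?subr_ge0// ltW.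
have := truncn_itv (nn _ ax); have := truncn_itv (nn _ ay).
rewrite -/(piece k x) -/(piece k y) -ix -iy.
rewrite ler_pdivlMr// ltr_pdivrMr// ler_pdivlMr// ltr_pdivrMr//.
rewrite -natr1 mulrDl mul1r => /andP[y1 y2] /andP[x1 x2].
by rewrite ler_norml; apply/andP; split; lra.
Qed.

End Label.

Section LabelEntropy.
Context {R : realType} (mu : probability (measurableTypeR R) R).
Local Notation T := (measurableTypeR R).
Context (w : T -> R) (V : set T) (eta a b : R) (d : nat -> R) (A gamma : R).
Context (mw : measurable_fun setT w) (mV : measurable V)
  (VI : V `<=` `[a, b]%classic) (d0 : forall k, 0 < d k)
  (wV : forall x, V x -> 0 <= w x <= expR (-1))
  (integral_le : (`| \int[mu]_(x in V) lne (w x)%:E | <= eta%:E)%E)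
  (A1 : 1 <= A) (g0 : 0 <= gamma)
  (dA : forall k, (b - a) / d k + 1 <= A * expR (gamma * k%:R)).

Context (ab : a <= b) (K B : nat)
  (hB : forall k, (k <= K)%N -> (pieces a b d k <= B.+1)%N).

Local Notation Y := (label w V a d K B).

Lemma label_moment (c : option (option ('I_K.+1 * 'I_B.+1)) -> R) :
  (forall u, 0 <= c u) -> c None = 0 -> (0 < K)%N -> c (Some None) <= K%:R ->
  (forall k i, c (Some (Some (k, i))) <= Num.max 1 k%:R) ->
  \sum_u c u * law mu Y u <= eta.
Proof.
move=> c0 cN K0 cS cSS; have mY : fmeas Y by exact: fmeas_label.
apply: (moment_le mw mV wV integral_le mY c0) => [x nV|x Vx wx].
  by rewrite /label asboolF.
have /andP[_ w1] := wV Vx.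
have lnw : 1 <= - ln (w x).
  have : ln (w x) <= -1 by rewrite -[leRHS]expRK ler_ln ?posrE// expR_gt0.
  by lra.
have := labelP w VI d0 x hB; case: label => [[[k i]|]|].
- move=> [_ _ kx _ _]; apply: le_trans (cSS k i) _; rewrite ge_max lnw kx.
  by apply: level_le_ln; rewrite (le_trans w1)// -[leRHS]expR0 ler_expR; lra.
- move=> [_ wK]; apply: le_trans cS _.
  have : ln (w x) <= - K%:R by rewrite -[leRHS]expRK ler_ln ?posrE ?expR_gt0// ltW.
  by lra.
- by rewrite cN => _; lra.
Qed.

Lemma law_label_rare : (0 < K)%N -> K%:R * law mu Y (Some None) <= eta.
Proof.
move=> K0; pose c (u : option (option ('I_K.+1 * 'I_B.+1))) : R :=
  if u is Some None then K%:R else 0.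
have := @label_moment c _ erefl K0 (lexx _) _; rewrite (bigD1 (Some None))//=.
rewrite [X in _ + X]big1 ?addr0; last by case=> [[p|]|]//; rewrite mul0r.
apply; first by case=> [[p|]|]/=.
by move=> k i; rewrite le_max ler01.
Qed.

(** The bound comes from the comparison with a geometric series of ratio 1/2. *)
Lemma sum_expRN n : \sum_(k < n) expR (- k%:R) <= 2 :> R.
Proof.
suff : \sum_(k < n) expR (- k%:R) <= 2 - 2 * 2^-1 ^+ n :> R.
  by have : 0 <= (2^-1 : R) ^+ n; [rewrite exprn_ge0|lra].
elim: n => [|n IH]; first by rewrite big_ord0 expr0; lra.
rewrite big_ord_recr/=; have e : expR (- n%:R) <= (2^-1 : R) ^+ n.
  rewrite expRN exprVn lef_pV2 ?posrE ?expR_gt0 ?exprn_gt0//.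
  rewrite -[X in expR X]mulr1 mulrC expRM_natr lerXn2r ?nnegrE ?expR_ge0//.
  by have := expR_ge1Dx (1 : R); lra.
by rewrite exprS; lra.
Qed.

Lemma sum_option (F : finType) (f : option F -> R) :
  \sum_u f u = f None + \sum_v f (Some v).
Proof.
rewrite (bigD1 None)//=; congr (_ + _).
rewrite (reindex_omap Some id)/=; last by case.
by apply: eq_bigl => v; rewrite eqxx.
Qed.

(** The weight of a label of level [k] in the tangent inequality is proportional
    to [expR (- (gamma + 1) k)]: as there are at most [A * expR (gamma k)] such
    labels the weights have a bounded sum, while minus their logarithm is
    affine in [k], hence has mean controlled by [eta]. The bound does not
    depend on [K]. *)
Lemma ent_label_le s : (0 < K)%N -> 0 < s <= 1 ->
  ent mu Y <= eta * (1 + gamma + ln A - ln s) + 3 * s.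
Proof.
move=> K0 /andP[s0 s1]; have mY : fmeas Y by exact: fmeas_label.
have A0 : 0 < A by exact: lt_le_trans A1.
pose c1 (u : option (option ('I_K.+1 * 'I_B.+1))) : R := if u is Some _ then 1 else 0.
pose c2 (u : option (option ('I_K.+1 * 'I_B.+1))) : R :=
  if u is Some (Some (k, _)) then k%:R else 0.
pose qk k := s / A * expR (- ((gamma + 1) * k%:R)).
have qk0 k : 0 < qk k by rewrite mulr_gt0 ?divr_gt0 ?expR_gt0.
pose Q (u : option (option ('I_K.+1 * 'I_B.+1))) : R :=
  if u is Some v then
    if v is Some (k, i) then if (i < pieces a b d k)%N then qk k else 0 else s
  else 0.
have h1 : \sum_u c1 u * law mu Y u <= eta.
  apply: label_moment => //; first by case.
  - by rewrite ler1n.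
  - by move=> k i; rewrite le_max lexx.
have h2 : \sum_u c2 u * law mu Y u <= eta.
  apply: label_moment => //; first by case=> [[[]|]|]/=.
  by move=> k i; rewrite le_max lexx orbT.
have hQ : \sum_u Q u <= 3 * s.
  rewrite !sum_option/= add0r sum_pair.
  suff : \sum_(k < K.+1) \sum_(i < B.+1) (if (i < pieces a b d k)%N then qk k else 0) <=
      \sum_(k < K.+1) s * expR (- k%:R).
    rewrite -mulr_sumr => h; have := ler_wpM2l (ltW s0) (sum_expRN K.+1).
    by move: h; lra.
  apply: ler_sum => k _; rewrite -big_mkcond/=.
  rewrite -(big_ord_widen _ (fun=> qk k)); last by apply: hB; rewrite -ltnS.
  rewrite sumr_const card_ord -[qk k *+ _]mulr_natl.
  have Mk : (pieces a b d k)%:R <= A * expR (gamma * k%:R).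
    apply: le_trans (dA k); rewrite /pieces -natr1 lerD2r.
    by have /truncn_itv/andP[] : 0 <= (b - a) / d k by rewrite divr_ge0 ?subr_ge0// ltW.
  apply: le_trans (ler_wpM2r (ltW (qk0 k)) Mk) _.
  rewrite /qk mulrACA [A * (s / A)]mulrCA mulfV ?gt_eqF// mulr1 -expRD.
  by rewrite (_ : gamma * k%:R - _ = - k%:R)//; ring.
have hN : phi (law mu Y None) <= \sum_u c1 u * law mu Y u.
  have := phi_tangent (law_ge0 mu Y None) ltr01; rewrite ln1 mulr0 oppr0 add0r.
  have := sum_law mu mY; rewrite sum_option => hsum.
  rewrite sum_option [c1 None]/= mul0r add0r.
  rewrite (eq_bigr (fun v => law mu Y (Some v))); last by move=> v _; rewrite mul1r.
  by lra.
have lnA : 0 <= ln A by rewrite ln_ge0.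
have key u : (if u is Some _ then phi (law mu Y u) else 0) <=
    c1 u * law mu Y u * (ln A - ln s - 1) + (gamma + 1) * (c2 u * law mu Y u) + Q u.
  case: u => [[[k i]|]|] /=; last by rewrite !mul0r; lra.
  - case: ifPn => ik.
      have := phi_tangent (law_ge0 mu Y (Some (Some (k, i)))) (qk0 k).
      rewrite {1}/qk lnM ?posrE ?divr_gt0 ?expR_gt0// ln_div ?posrE// expRK.
      by lra.
    have -> : law mu Y (Some (Some (k, i))) = 0.
      rewrite /law /mass (_ : _ @^-1` _ = set0) ?measure0//.
      apply/seteqP; split=> x //= lx; have := labelP w VI d0 x hB.
      by rewrite lx => -[_ _ _ _]; apply/negP.
    by rewrite phi0 !mulr0 mul0r; lra.
  - have := phi_tangent (law_ge0 mu Y (Some None)) s0.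
    have := mulr_ge0 (law_ge0 mu Y (Some None)) lnA.
    by lra.
set m := \sum_u c1 u * law mu Y u in h1 hN.
have h : \sum_v phi (law mu Y (Some v)) <=
    m * (ln A - ln s - 1) + (gamma + 1) * (\sum_u c2 u * law mu Y u) + \sum_u Q u.
  rewrite /m mulr_suml mulr_sumr -!big_split/= [leRHS]sum_option.
  rewrite [X in X + _](_ : _ = 0); last by rewrite /= !mul0r mulr0 !addr0.
  by rewrite add0r; apply: ler_sum => v _; exact: (key (Some v)).
rewrite /ent sum_option.
have lns : 0 <= ln A - ln s by have := ln_le0 s1; lra.
have := ler_wpM2r lns h1.
have g1 : 0 <= gamma + 1 by rewrite addr_ge0.
have := ler_wpM2l g1 h2.
by lra.
Qed.

End LabelEntropy.

(** * Small intervals capture the entropy, uniformly over the class *)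

Section Clamp.
Context {R : realType} (a b : R) (ab : a <= b).

(** Composing with this retraction extends a map of the interval to a continuous
    map of the line, for which a measure carried by the interval is still
    invariant. *)
Definition clamp x := Num.max a (Num.min b x).

Lemma clamp_in x : clamp x \in `[a, b].
Proof. by rewrite in_itv/= le_max lexx/= ge_max ab ge_min lexx. Qed.

Lemma clamp_id x : x \in `[a, b] -> clamp x = x.
Proof.
by rewrite in_itv/= => /andP[ax xb]; rewrite /clamp min_r// max_r.
Qed.

Lemma clamp_lipschitz x y : `|clamp x - clamp y| <= `|x - y|.
Proof.
wlog xy : x y / x <= y => [hw|].
  by have [/hw//|/ltW/hw] := leP x y; rewrite distrC [leRHS]distrC.
have cxy : clamp x <= clamp y by rewrite /clamp le_max2// le_min2.
rewrite distrC [leRHS]distrC !ger0_norm ?subr_ge0//.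
move: cxy; rewrite /clamp !minElt !maxElt.
by do !case: ifP => /=; move=> *; try lra.
Qed.

Lemma continuous_clamp (phi : R -> R) :
  {within `[a, b], continuous phi} -> continuous (phi \o clamp).
Proof.
move=> /subspace_continuousP cphi x; apply/cvgrPdist_lt => e e0.
have /cvgrPdist_lt/(_ _ e0)/nbhs_ballP[d /= d0 hd] := cphi _ (clamp_in x).
apply/nbhs_ballP; exists d => //= y; rewrite /ball/= => xy.
apply: hd; last exact: clamp_in.
by rewrite /ball/= (le_lt_trans (clamp_lipschitz _ _)).
Qed.

End Clamp.

Section BadTimes.
Context {R : realType} d (T : measurableType d) (mu : probability T R) (g : T -> T).
Context (mg : measurable_fun setT g)
  (mu_inv : forall A, measurable A -> mu (g @^-1` A) = mu A).

Lemma mass_block_bad (F : finType) (Q : T -> F) (good : pred F) n : fmeas Q ->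
  mass mu (block g Q n @^-1` [set v | ~~ [forall i, good (v i)]]) <=
  n%:R * mass mu (Q @^-1` [set u | ~~ good u]).
Proof.
move=> mQ; set C := Q @^-1` _; have mC : measurable C by exact: fmeas_preimage.
pose A k := [set x | exists2 i, (i < k)%N & C (iter i g x)].
have AS k : A k.+1 = A k `|` (iter k g @^-1` C).
  apply/seteqP; split=> x /=.
    move=> [i]; rewrite ltnS leq_eqVlt => /predU1P[->|ik] Ci; first by right.
    by left; exists i.
  by move=> [[i ik Ci]|Ck]; [exists i => //; exact: ltnW|exists k].
have mA k : measurable (A k).
  elim: k => [|k IH].
    by rewrite (_ : A 0%N = set0)// -subset0 => x [].
  by rewrite AS; apply: measurableU => //; exact: measurable_preimage_iter.
have -> : block g Q n @^-1` [set v | ~~ [forall i, good (v i)]] = A n.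
  apply/seteqP; split=> x /=.
    by move=> /forallPn[i]; rewrite ffunE => Ci; exists i.
  move=> [i ik Ci]; apply/forallPn; exists (Ordinal ik).
  by rewrite ffunE.
elim: n => [|n IH].
  rewrite mul0r (_ : A 0%N = set0)//; last by rewrite -subset0 => x [].
  by rewrite /mass measure0.
rewrite AS -natr1 mulrDl mul1r.
have mi := measurable_preimage_iter mg n mC.
have := mass_setU_le mu (mA n) mi.
have -> : mass mu (iter n g @^-1` C) = mass mu C.
  by rewrite /mass (measure_preimage_iter mg mu_inv n mC).
by move: IH; lra.
Qed.

End BadTimes.

Section TailEntropy.
Context {R : realType} (a b : R) (f : R -> R) (ab : a < b).
Local Notation I := `[a, b]%classic.
Local Notation T := (measurableTypeR R).
Local Notation h := (deriv_in I f).
Context (fI : forall x, x \in `[a, b] -> f x \in `[a, b])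
  (df : forall x, x \in `[a, b] -> derivable_in I f x)
  (ch : {within `[a, b], continuous h}).

Let g : T -> T := f \o clamp a b.
Let w : T -> R := fun x => `|h (clamp a b x)|.

Lemma measurable_clamp_map : measurable_fun setT g.
Proof.
apply: (continuous_measurable_fun (f := f \o clamp a b)).
by apply: continuous_clamp; [exact: ltW|exact: derivable_in_continuous].
Qed.

Lemma measurable_deriv : measurable_fun setT w.
Proof.
apply: (measurableT_comp (f := @Num.norm R R)); first exact: normr_measurable.
apply: (continuous_measurable_fun (f := h \o clamp a b)).
by apply: continuous_clamp; [exact: ltW|exact: ch].
Qed.

Lemma deriv_away (U : set R) : open U -> (forall x, I x -> h x = 0 -> U x) ->
  exists2 c : R, 0 < c & forall x, I x -> ~ U x -> c <= `|h x|.
Proof.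
move=> oU zU; have [A0|/set0P A0] := eqVneq (I `\` U) set0.
  exists 1 => // x Ix nU; suff : (I `\` U) x by rewrite A0.
  by split.
have cA : compact (I `\` U).
  apply: (subclosed_compact _ (@segment_compact _ a b)) => //.
  by apply: closedI; [exact: interval_closed|exact: open_closedC].
have ch' : {within I `\` U, continuous (fun x => `|h x|)}.
  apply: (@continuous_subspaceW _ _ _ I); first by move=> x [].
  move=> x; apply: continuous_comp; [exact: ch|exact: norm_continuous].
have [c cA' hc] := compact_EVT_min A0 cA ch'.
exists `|h c|; last by move=> x Ix nU; apply: hc; rewrite inE.
move: cA'; rewrite inE => -[Ic nU]; rewrite normr_gt0; apply/eqP => hc0.
by apply: nU; exact: zU.
Qed.

Lemma clamp_map_id x : x \in `[a, b] -> g x = f x.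
Proof. by move=> xI; rewrite /g /= clamp_id. Qed.

Lemma osc_monotone (E : set R) x0 (c e : R) : E `<=` I -> E x0 ->
  c <= `|h x0| -> (forall x y, E x -> E y -> `|x - y| <= e) ->
  (forall x y, I x -> I y -> `|x - y| <= e -> `|h x - h y| < c) ->
  monotone_on E g.
Proof.
move=> EI Ex0 cx0 diamE osc.
have fm : monotone_on E f.
  apply: (monotone_of_deriv df EI (x0 := x0)) => x y z Ex Ey /andP[xz zy].
  apply: lt_le_trans cx0; apply: osc; first exact: EI.
    have := EI _ Ex; have := EI _ Ey; rewrite /= !in_itv/=.
    by move=> /andP[? ?] /andP[? ?]; apply/andP; split; lra.
  have := diamE _ _ Ex0 Ex; have := diamE _ _ Ex0 Ey.
  by rewrite !ler_norml => /andP[? ?] /andP[? ?]; apply/andP; split; lra.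
by case: fm => fm; [left|right] => x y Ex Ey xy;
  rewrite !clamp_map_id; do ?exact: EI; exact: fm.
Qed.

Section Tail.
Context (mu : probability T R) (U : set R) (eta s : R) (A gamma : R) (d : nat -> R)
  (k0 : nat).
Local Notation V := (U `&` I).
Context (mu_inv : forall A, measurable A -> mu (g @^-1` A) = mu A)
  (muI : mu I = 1%E) (oU : open U)
  (hV : forall x, V x -> `|h x| <= expR (-1))
  (integral_le : (`| \int[mu]_(x in V) lne (`|h x|)%:E | <= eta%:E)%E)
  (A1 : 1 <= A) (g0 : 0 <= gamma) (d0 : forall k, 0 < d k)
  (dosc : forall k x y, I x -> I y -> `|x - y| <= d k ->
     `|h x - h y| < expR (- (k.+1)%:R))
  (dA : forall k, (b - a) / d k + 1 <= A * expR (gamma * k%:R))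
  (hU : forall x, I x -> ~ U x -> expR (- (k0.+1)%:R) <= `|h x|)
  (s0 : 0 < s <= 1).
Context (Np : nat) (p : 'I_Np -> R)
  (mesh : forall x y, I x -> I y -> thr p x = thr p y -> `|x - y| <= d k0).

Let bigB K := \max_(k < K.+1) pieces a b d k.

Let bigBP K k : (k <= K)%N -> (pieces a b d k <= (bigB K).+1)%N.
Proof.
move=> kK; apply: leqW; have kK' : (k < K.+1)%N by [].
exact: (leq_bigmax (F := fun k : 'I_K.+1 => pieces a b d k) (Ordinal kK')).
Qed.

Let lab K := label w V a d K (bigB K).

Let Q K := joint (thr p) (joint (lab K) (isin I)).

(** The cells on which [g] is monotone. The points off the interval form a null
    set and are discarded with those of level beyond [K]. *)
Let good K (u : {ffun 'I_Np -> bool} * (option (option ('I_K.+1 * 'I_(bigB K).+1)) * bool)) :=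
  (u.2.1 != Some None) && u.2.2.

Let wE x : I x -> w x = `|h x|.
Proof. by move=> Ix; rewrite /w clamp_id. Qed.

Let VI : V `<=` I. Proof. by move=> x []. Qed.

(** Off [V] the derivative is bounded below and the mesh of [p] is chosen
    accordingly; on [V] two points with the same label are close in comparison
    with the size of the derivative at either. *)
Lemma good_monotone K u : good (K := K) u -> monotone_on (Q K @^-1` [set u]) g.
Proof.
case: u => c [y i] /andP[/= yN iT].
have QP x : (Q K @^-1` [set (c, (y, i))]) x -> [/\ thr p x = c, lab K x = y & I x].
  move=> /= [cx yx ix]; split=> //.
  by apply/asboolP; move: ix iT; rewrite /isin => ->.
have EI : Q K @^-1` [set (c, (y, i))] `<=` I by move=> x /QP[].
have [E0|/set0P[x0 Ex0]] := eqVneq (Q K @^-1` [set (c, (y, i))]) set0.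
  by left=> x y' Ex; exfalso; move: Ex; rewrite E0.
have [cx0 yx0 Ix0] := QP _ Ex0.
have := labelP w VI d0 x0 (@bigBP K); rewrite -/(lab K x0) yx0.
case: y yN QP EI Ex0 yx0 => [[[k j]|]|]// _ QP EI Ex0 yx0.
- move=> [_ wK kx0 _ _].
  apply: (osc_monotone EI Ex0 (c := expR (- (k.+1)%:R)) (e := d k)).
  + rewrite -wE// kx0 ltW// expR_level_lt//.
    by apply: lt_le_trans wK; exact: expR_gt0.
  + move=> x y /QP[_ yx _] /QP[_ yy _].
    exact: (label_close VI d0 (@bigBP K) yx yy).
  + exact: dosc.
- move=> nV; apply: (osc_monotone EI Ex0 (c := expR (- (k0.+1)%:R)) (e := d k0)).
  + by apply: hU => // Ux0; apply: nV.
  + by move=> x y /QP[cx _ Ix] /QP[cy _ Iy]; apply: mesh => //; rewrite cx cy.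
  + exact: dosc.
Qed.

Let mV : measurable (V : set T).
Proof. by apply: measurableI => //; exact: open_measurable. Qed.

Let mlab K : fmeas (T := T) (lab K).
Proof. by apply: fmeas_label; [exact: measurable_deriv|exact: mV]. Qed.

Let mI : fmeas (T := T) (isin I).
Proof. exact: fmeas_isin. Qed.

Let mQ K : fmeas (T := T) (Q K).
Proof.
apply: (fmeas_joint (T := T)); first exact: fmeas_thr.
by apply: (fmeas_joint (T := T)).
Qed.

Let integral_w : (`| \int[mu]_(x in V) lne (w x)%:E | <= eta%:E)%E.
Proof.
have -> : (\int[mu]_(x in V) lne (w x)%:E = \int[mu]_(x in V) lne (`|h x|)%:E)%E.
  by apply: eq_integral => x; rewrite inE => -[_ Ix]; rewrite (wE Ix).
exact: integral_le.
Qed.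

Let wV x : V x -> 0 <= w x <= expR (-1).
Proof. by move=> Vx; rewrite normr_ge0/= wE ?hV//; exact: VI. Qed.

Lemma mass_bad K : (0 < K)%N ->
  mass mu (Q K @^-1` [set u | ~~ good (K := K) u]) <= eta / K%:R.
Proof.
move=> K0; rewrite ler_pdivlMr ?ltr0n// mulrC.
apply: le_trans (law_label_rare measurable_deriv mV VI d0 wV integral_w (@bigBP K) K0).
rewrite ler_pM2l ?ltr0n//.
have mC : measurable (~` (I : set T)) by exact: measurableC.
have mL : measurable (lab K @^-1` [set Some None]) by exact: (mlab (K := K)).
apply: (@le_trans _ _ (mass mu (lab K @^-1` [set Some None] `|` ~` I))).
  apply: mass_le; [exact: (fmeas_preimage _ (mQ (K := K)))|exact: measurableU|].
  move=> x /=; rewrite /good /Q /joint /= negb_and negbK.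
  by move=> /orP[/eqP ?|/asboolPn ?]; [left|right].
by apply: le_trans (mass_setU_le mu mL mC) _; rewrite mass_setC_full// addr0.
Qed.

Lemma ent_isin_itv : ent mu (isin I) <= s.
Proof.
have mC : measurable (~` (I : set T)) by exact: measurableC.
have /andP[s0' _] := s0.
apply: (@le_trans _ _ (ent mu (isin (~` I)))).
  apply: ent_le; first exact: fmeas_isin.
  by move=> x y; rewrite /isin !asbool_neg => /negb_inj.
by apply: le_trans (ent_isin_le mu mC s0') _; rewrite mass_setC_full// mul0r subr0.
Qed.

(** Given the itinerary through the cells of [Q K], a point that meets only good
    cells has at most [n * N + 1] itineraries with respect to [t]. The other
    points have mass at most [n * eta / K], and here [n] is fixed while [K]
    tends to infinity, so that they disappear; the cost of passing from [p] to
    [Q K] is the entropy of the label, which is bounded independently of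
    [K]. *)
Lemma ent_block_thr_le N (t : 'I_N -> R) n :
  ent mu (block g (thr t) n) <= ent mu (block g (thr p) n) +
    n%:R * (eta * (1 + gamma + ln A - ln s) + 4 * s) + ln (n * N + 1)%:R.
Proof.
have mg := measurable_clamp_map.
have mt : fmeas (T := T) (thr t) by exact: fmeas_thr.
have mp : fmeas (T := T) (thr p) by exact: fmeas_thr.
set E := eta * _ + _; apply/ler_addgt0Pr => e e0.
pose L : R := ln #|{ffun 'I_n -> {ffun 'I_N -> bool}}|%:R.
have L0 : 0 <= L.
  by rewrite /L; case: #|_| => [|m]; [rewrite ln0|rewrite ln_ge0// ler1n].
(* K is large enough for the bad points to contribute at most e *)
pose K := (Num.truncn (n%:R * eta * L / e)).+1.
have hK : n%:R * (eta / K%:R) * L <= e.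
  have K0' : 0 < K%:R :> R by rewrite ltr0n.
  have : n%:R * eta * L / e <= K%:R by apply/ltW; exact: truncnS_gt.
  rewrite ler_pdivrMr// => hK.
  rewrite mulrA (mulrAC _ K%:R^-1) ler_pdivrMr//.
  by move: hK; lra.
have mQK := mQ (K := K).
have centQ : cent mu (Q K) (thr p) <= E.
  have mY := mlab (K := K).
  have mYI : fmeas (T := T) (joint (lab K) (isin I)) by exact: fmeas_joint.
  apply: le_trans (cent_extend mu mYI mp) _.
  apply: le_trans (ent_joint_le mu mY mI) _.
  have := ent_label_le measurable_deriv mV VI d0 wV integral_w A1 g0 dA (ltW ab)
    (@bigBP K) (ltn0Sn _) s0.
  by have := ent_isin_itv; rewrite /E -/(lab K); lra.
have centX : cent mu (block g (thr t) n) (block g (Q K) n) <=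
    ln (n * N + 1)%:R + n%:R * (eta / K%:R) * L.
  have M0 : (0 < n * N + 1)%N by rewrite addn1.
  have := @cent_count _ _ _ mu _ _ (block g (thr t) n) (block g (Q K) n)
    (fun v => [forall i, good (v i)]) (n * N + 1)%N
    (fmeas_block mg mt) (fmeas_block mg mQK) M0.
  move=> h; apply: le_trans (h _) _.
    move=> v /forallP gv; apply: card_thr_codes => i ni.
    exact: (monotone_iter (@good_monotone K) gv (ltnW ni)).
  rewrite lerD2l ler_wpM2r//.
  apply: le_trans (mass_block_bad mg mu_inv (@good K) n mQK) _.
  by rewrite ler_wpM2l// mass_bad.
have := ent_le_cent mu (fmeas_block mg mt (n := n)) (fmeas_block mg mQK (n := n)).
have := ent_block_le mg mu_inv n mQK mp.
have := ler_wpM2l (ler0n R n) centQ.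
by lra.
Qed.

Lemma entropy_rate_tail (F : finType) (X : T -> F) : fmeas X ->
  entropy_rate mu g X <=
  entropy_rate mu g (thr p) + (eta * (1 + gamma + ln A - ln s) + 4 * s).
Proof.
move=> mX; have mg := measurable_clamp_map.
have [_ aX] := approximable_fmeas mu mX.
apply/ler_addgt0Pr => e e0; have e20 : 0 < e / 2 by rewrite divr_gt0.
have [N [t ht]] := aX _ e20; have [C hC] := ln_affine N e20.
have mt : fmeas (T := T) (thr t) by exact: fmeas_thr.
have mp : fmeas (T := T) (thr p) by exact: fmeas_thr.
have h1 := entropy_rate_cent mg mu_inv mX mt.
set E := eta * _ + _.
have : entropy_rate mu g (thr t) <= entropy_rate mu g (thr p) + (E + e / 2).
  apply: (entropy_rate_le mg mu_inv (C := C)) => // n.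
  by have := ent_block_thr_le t n; have := hC n; rewrite -/E; lra.
by lra.
Qed.

End Tail.

End TailEntropy.

(** * Continuity sets for the weak-star topology *)

Section WeakStarContinuity.
Context {R : realType} (I : set R).
Local Notation T := (measurableTypeR R).
Implicit Types mu : probability T R.

Lemma near_integral (mu0 : weak_star I) (phi : continuous_in I) (e : R) : 0 < e ->
  \forall mu \near mu0, `|(integrals (mu0 : probability T R) phi : R) -
     integrals (mu : probability T R) phi| < e.
Proof.
move=> e0.
have c1 : {for mu0, continuous (@integrals R I : weak_star I -> _)}.
  exact: (@initial_continuous _ _ (@integrals R I) mu0).
have c2 : {for integrals (mu0 : probability T R),
    continuous (fun u : {ptws continuous_in I -> R} => u phi : R)}.
  exact: (@proj_continuous {classic continuous_in I} (fun=> R) phi).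
have c := continuous_comp c1 c2.
move/cvgrPdist_lt : c => /(_ e e0).
exact.
Qed.

(** The sets with a negligible boundary, described through continuous functions
    that squeeze their indicator: in this form the class is visibly stable under
    boolean operations and under preimages by continuous measure-preserving
    maps, and its members have mass depending continuously on the measure. *)
Definition squeezed (mu : probability T R) (A : set R) (e : R) (u v : R -> R) :=
  [/\ continuous u, continuous v, forall x, [/\ 0 <= u x, u x <= v x & v x <= 1],
    forall x, (A x -> v x = 1) /\ (~ A x -> u x = 0) &
    mass mu [set x | u x < v x] <= e].

Definition jordan (mu : probability T R) (A : set R) :=
  forall e : R, 0 < e -> exists u v, squeezed mu A e u v.

Lemma measurable_gap (u v : R -> R) : continuous u -> continuous v ->
  measurable ([set x | u x < v x] : set T).
Proof.
move=> cu cv.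
have := measurable_fun_ltr (continuous_measurable_fun cu) (continuous_measurable_fun cv).
by move=> /(_ measurableT [set true]); rewrite setTI; exact.
Qed.

Lemma jordanC mu A : jordan mu A -> jordan mu (~` A).
Proof.
move=> jA e e0; have [u [v [cu cv uv uvA m]]] := jA e e0.
have Av x := (uvA x).1; have Au x := (uvA x).2.
exists (fun x => 1 - v x), (fun x => 1 - u x); split.
- by move=> x; apply: continuousB; [exact: cst_continuous|exact: cv].
- by move=> x; apply: continuousB; [exact: cst_continuous|exact: cu].
- by move=> x; have [] := uv x; split; lra.
- move=> x; split; first by move=> /Au ->; rewrite subr0.
  by move=> /contrapT/Av ->; rewrite subrr.
- rewrite (_ : [set x | _] = [set x | u x < v x])//.
  by apply/seteqP; split=> x /=; lra.
Qed.

Lemma jordanI mu A B : jordan mu A -> jordan mu B -> jordan mu (A `&` B).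
Proof.
move=> jA jB e e0; have e20 : 0 < e / 2 by rewrite divr_gt0.
have [u [v [cu cv uv uvA m]]] := jA _ e20.
have Av x := (uvA x).1; have Au x := (uvA x).2.
have [u' [v' [cu' cv' uv' uvB m']]] := jB _ e20.
have Bv x := (uvB x).1; have Bu x := (uvB x).2.
exists (fun x => u x * u' x), (fun x => v x * v' x); split.
- by move=> x; apply: continuousM; [exact: cu|exact: cu'].
- by move=> x; apply: continuousM; [exact: cv|exact: cv'].
- move=> x; have [u0 uvx v1] := uv x; have [u0' uvx' v1'] := uv' x; split.
  + exact: mulr_ge0.
  + exact: ler_pM.
  + by apply: mulr_ile1 => //; [exact: le_trans uvx|exact: le_trans uvx'].
- move=> x; split; first by move=> [/Av -> /Bv ->]; rewrite mulr1.
  by move=> /not_andP[/Au ->|/Bu ->]; rewrite (mul0r, mulr0).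
- have mD := measurable_gap cu cv; have mD' := measurable_gap cu' cv'.
  have mD2 : measurable ([set x | u x * u' x < v x * v' x] : set T).
    apply: (measurable_gap (u := fun x => u x * u' x) (v := fun x => v x * v' x)).
      by move=> x; apply: continuousM; [exact: cu|exact: cu'].
    by move=> x; apply: continuousM; [exact: cv|exact: cv'].
  apply: (@le_trans _ _ (mass mu ([set x | u x < v x] `|` [set x | u' x < v' x]))).
    apply: mass_le => //; first exact: measurableU.
    move=> x /=; rewrite -/(_ \/ _); have [u0 uvx v1] := uv x.
    have [u0' uvx' v1'] := uv' x; apply: contraPP => /not_orP[/negP + /negP].
    rewrite -!leNgt => vu vu'; apply/negP; rewrite -leNgt ler_pM//.
      exact: le_trans uvx.
    exact: le_trans uvx'.
  have := mass_setU_le mu mD mD'.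
  by move: m m'; lra.
Qed.

Lemma jordan_preimage mu A (g : R -> R) : continuous g ->
  (forall B : set T, measurable B -> mu (g @^-1` B) = mu B) ->
  jordan mu A -> jordan mu (g @^-1` A).
Proof.
move=> cg mu_inv jA e e0; have [u [v [cu cv uv uvA m]]] := jA e e0.
have Av x := (uvA x).1; have Au x := (uvA x).2.
exists (u \o g), (v \o g); split.
- by move=> x; apply: continuous_comp; [exact: cg|exact: cu].
- by move=> x; apply: continuous_comp; [exact: cg|exact: cv].
- by move=> x; exact: uv.
- by move=> x; exact: (uvA (g x)).
- apply: le_trans m; rewrite /mass.
  by rewrite -(mu_inv _ (measurable_gap cu cv)).
Qed.

Lemma jordan_bigcap mu (F : finType) (A : F -> set R) :
  jordan mu setT -> (forall i, jordan mu (A i)) ->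
  jordan mu (\bigcap_(i in [set: F]) A i).
Proof.
move=> jT jA; suff : forall s : seq F, jordan mu (\bigcap_(i in [set` s]) A i).
  move=> /(_ (enum F)); congr jordan; apply/seteqP; split=> x h i _; apply: h => //=.
  by rewrite mem_enum.
elim=> [|i s IH].
  by rewrite set_nil bigcap_set0.
rewrite (_ : \bigcap_(j in _) A j = A i `&` \bigcap_(j in [set` s]) A j).
  exact: jordanI.
apply/seteqP; split=> x /=.
  by move=> h; split=> [|j js]; apply: h; rewrite /= inE ?eqxx// js orbT.
by move=> [h1 h2] j /=; rewrite inE => /predU1P[->//|]; exact: h2.
Qed.

Lemma jordanT mu : jordan mu setT.
Proof.
move=> e e0; exists (fun=> 1), (fun=> 1); split=> //; do ?exact: cst_continuous.
  by move=> x; split=> // nT; exfalso; exact: nT.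
rewrite [X in mass mu X](_ : _ = set0) ?/mass ?measure0 ?ltW//.
by apply/seteqP; split=> x /=; rewrite ltxx.
Qed.

(** The indicator is squeezed between two ramps on either side of [t]. *)
Lemma jordan_itv mu (t : R) : mu [set t] = 0%E -> jordan mu [set x | x <= t].
Proof.
move=> t0 e e0.
pose F n : set T := `[t - n.+1%:R^-1, t + n.+1%:R^-1]%classic.
have [|||n hn] := mass_vanish _ _ _ e0 (mu := mu) (F := F).
- by move=> i; exact: measurable_itv.
- move=> i j ij; apply: subset_itv; rewrite bnd_simp.
    by rewrite lerB// lef_pV2 ?posrE// ler_nat ltnS.
  by rewrite lerD2l lef_pV2 ?posrE// ler_nat ltnS.
- rewrite (_ : \bigcap_i F i = [set t])//; apply/seteqP; split=> x /=; last first.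
    by move=> -> i _; rewrite /F /= in_itv/= gerBl lerDl invr_ge0 ler0n.
  move=> h; apply/eqP; rewrite -subr_eq0 -normr_le0.
  apply/ler_addgt0Pr => e' e'0; rewrite add0r.
  have := h (Num.truncn e'^-1) Logic.I; rewrite /F /= in_itv/=.
  have : ((Num.truncn e'^-1).+1%:R : R)^-1 <= e'.
    by rewrite -[leRHS]invrK lef_pV2 ?posrE ?invr_gt0// ltW// truncnS_gt.
  move=> h1 /andP[h2 h3]; rewrite ler_distl (le_trans _ h2) ?lerD2l ?lerN2//.
  by rewrite (le_trans h3)// lerD2l.
pose c (x : R) := Num.max 0 (Num.min 1 x).
have cc : continuous c.
  move=> x; apply: (@continuous_max R R (fun=> 0) (fun x => Num.min 1 x)).
    exact: cst_continuous.
  by apply: (@continuous_min R R (fun=> 1) id); [exact: cst_continuous|].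
have k0 : 0 < n.+1%:R :> R by [].
have cz0 z : z <= 0 -> c z = 0.
  by move=> z0; rewrite /c max_l// ge_min z0 orbT.
have cz1 z : 1 <= z -> c z = 1.
  by move=> z1; rewrite /c min_l// max_r.
have c01 z : 0 <= c z <= 1 by rewrite /c le_max lexx/= ge_max ler01 ge_min lexx.
have cmono y z : y <= z -> c y <= c z by move=> yz; rewrite /c le_max2// le_min2.
pose z x := (t - x) * n.+1%:R; have cz : continuous z.
  move=> x; apply: (@continuousM R R (fun x => t - x) (fun=> n.+1%:R)).
    by apply: (@continuousB _ _ _ (fun=> t) id); [exact: cst_continuous|].
  exact: cst_continuous.
exists (c \o z), (fun x => c (1 + z x)); split.
- by move=> x; apply: continuous_comp; [exact: cz|exact: cc].
- move=> x; apply: (@continuous_comp _ _ _ (fun x => 1 + z x) c); last exact: cc.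
  by apply: continuousD; [exact: cst_continuous|exact: cz].
- move=> x; have /andP[h1 _] := c01 (z x); have /andP[_ h2] := c01 (1 + z x).
  by split=> //=; apply: cmono; rewrite lerDr.
- move=> x; split=> /= xt.
    by apply: cz1; rewrite lerDl mulr_ge0 ?subr_ge0.
  by apply: cz0; rewrite mulr_le0_ge0// subr_le0 ltW// ltNge; apply/negP.
- apply: le_trans (ltW hn); apply: mass_le.
  + apply: (@measurable_gap (c \o z) (fun x => c (1 + z x))).
      by move=> x; apply: continuous_comp; [exact: cz|exact: cc].
    move=> x; apply: (@continuous_comp _ _ _ (fun x => 1 + z x) c); last exact: cc.
    by apply: continuousD; [exact: cst_continuous|exact: cz].
  + exact: measurable_itv.
  + move=> x /= uv; rewrite /F /= in_itv/= lerBlDr -lerBlDl -[X in _ && X]lerBlDl.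
    have [z1|z1] := leP 1 (z x).
      by move: uv; rewrite (cz1 _ z1) (cz1 (1 + z x)) ?ltxx// lerDl (le_trans _ z1).
    have [z2|z2] := leP (1 + z x) 0.
      by move: uv; rewrite (cz0 _ z2) (cz0 (z x)) ?ltxx//; lra.
    rewrite -[X in _ <= X]mul1r ler_pdivlMr// ltW//=.
    by rewrite -[leRHS]mul1r ler_pdivlMr//; move: z2; rewrite /z; lra.
Qed.

Context (mI : measurable (I : set T)).

Lemma Rintegral_bounds mu (v : R -> R) : continuous v -> (forall x, 0 <= v x <= 1) ->
  (\int[mu]_(x in I) (v x)%:E)%E = (\int[mu]_(x in I) v x)%:E.
Proof.
move=> cv v01; have mv : measurable_fun (I : set T) (fun x => (v x)%:E).
  apply/measurable_EFinP; apply: measurable_funTS.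
  exact: continuous_measurable_fun.
rewrite /Rintegral fineK// ge0_fin_numE.
  apply: (@le_lt_trans _ _ (\int[mu]_(x in I) (1%:E))%E).
    apply: ge0_le_integral => //; first by move=> x _; rewrite lee_fin; case/andP: (v01 x).
    by move=> x _; rewrite lee_fin; case/andP: (v01 x).
  rewrite integral_cst// mul1e (le_lt_trans (probability_le1 mu mI))//.
  exact: ltry.
by apply: integral_ge0 => x _; rewrite lee_fin; case/andP: (v01 x).
Qed.

Lemma mass_le_Rintegral mu (A : set T) (v : R -> R) :
  mu I = 1%E -> measurable A -> continuous v -> (forall x, 0 <= v x <= 1) ->
  (forall x, A x -> v x = 1) -> mass mu A <= \int[mu]_(x in I) v x.
Proof.
move=> muI mA cv v01 Av; rewrite -lee_fin -Rintegral_bounds// -massE//.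
rewrite -(measureI_full mI muI mA) setIC.
rewrite -integral_indic//; apply: ge0_le_integral => //.
- by apply/measurable_EFinP; exact: measurable_indic.
- by apply/measurable_EFinP; apply: measurable_funTS; exact: continuous_measurable_fun.
- move=> x _; rewrite lee_fin indicE; have [Ax|nA] := pselect (A x).
    by rewrite mem_set// Av.
  by rewrite memNset//; case/andP: (v01 x).
Qed.

Lemma Rintegral_le_mass mu (A : set T) (v : R -> R) :
  measurable A -> continuous v -> (forall x, 0 <= v x <= 1) ->
  (forall x, ~ A x -> v x = 0) -> \int[mu]_(x in I) v x <= mass mu A.
Proof.
move=> mA cv v01 Av; rewrite -lee_fin -Rintegral_bounds// -massE//.
have mAI : measurable (A `&` (I : set T)) by exact: measurableI.
apply: (@le_trans _ _ (mu (A `&` (I : set T)))); last by apply: le_measure; rewrite ?inE.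
rewrite -integral_indic//; apply: ge0_le_integral => //.
- by move=> x _; rewrite lee_fin; case/andP: (v01 x).
- by apply/measurable_EFinP; apply: measurable_funTS; exact: continuous_measurable_fun.
- by apply/measurable_EFinP; exact: measurable_indic.
- move=> x _; rewrite lee_fin indicE; have [Ax|nA] := pselect (A x).
    by rewrite mem_set//; case/andP: (v01 x).
  by rewrite memNset// Av.
Qed.

Lemma jordan_near_le (mu0 : weak_star I) (A : set T) (e : R) :
  (mu0 : probability T R) I = 1%E -> measurable A -> jordan mu0 A -> 0 < e ->
  \forall mu \near mu0, (mu : probability T R) I = 1%E ->
    mass (mu : probability T R) A <= mass (mu0 : probability T R) A + e.
Proof.
move=> muI mA jA e0; have e20 : 0 < e / 2 by rewrite divr_gt0.
have [u [v [cu cv uv uvA m]]] := jA _ e20.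
have cvI : {within I, continuous v} by exact: continuous_subspaceT.
have := near_integral mu0 (exist _ v cvI) e20.
apply: filterS => mu; rewrite /integrals /= => h mu1.
have v01 x : 0 <= v x <= 1.
  by have [u0 uvx ->] := uv x; rewrite (le_trans u0 uvx).
have h1 := mass_le_Rintegral mu1 mA cv v01 (fun x => (uvA x).1).
have mD := measurable_gap cu cv.
have mAD : measurable (A `|` ([set x | u x < v x] : set T)) by exact: measurableU.
have h2 := @Rintegral_le_mass (mu0 : probability T R) _ _ mAD cv v01.
have {}h2 := h2 _; have h3 := mass_setU_le (mu0 : probability T R) mA mD.
have h4 : \int[mu0 : probability T R]_(x in I) v x <=
    mass (mu0 : probability T R) (A `|` ([set x | u x < v x] : set T)).
  apply: h2 => x /not_orP[/(uvA x).2 ux /negP]; rewrite -leNgt ux => vx0.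
  by apply/eqP; rewrite eq_le vx0; case/andP: (v01 x).
by move: h; rewrite ltr_distl => /andP[h5 h6]; move: h1 h3 h4 m h5 h6; lra.
Qed.

Lemma jordan_near (mu0 : weak_star I) (A : set T) (e : R) :
  (mu0 : probability T R) I = 1%E -> measurable A -> jordan mu0 A -> 0 < e ->
  \forall mu \near mu0, (mu : probability T R) I = 1%E ->
    `|mass (mu : probability T R) A - mass (mu0 : probability T R) A| <= e.
Proof.
move=> muI mA jA e0; have mC : measurable (~` A) by exact: measurableC.
have h1 := jordan_near_le muI mA jA e0.
have h2 := jordan_near_le muI mC (jordanC jA) e0.
have compl (mu : probability T R) : mass mu (~` A) = 1 - mass mu A.
  apply: EFin_inj; rewrite EFinB -!massE//; first exact: probability_setC.
apply: filterS2 h1 h2 => mu l1 l2 mu1; move: (l1 mu1) (l2 mu1).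
by rewrite !compl => ? ?; rewrite ler_norml; apply/andP; split; lra.
Qed.

(** The tangent inequality at the laws for [mu0] bounds the entropy for [mu] by an
    affine function of its masses, which agrees with the entropy at [mu0]. At a
    value of mass 0 the tangent is taken at a small [s] instead. *)
Lemma ent_near (mu0 : weak_star I) (F : finType) (X : T -> F) (e : R) :
  (mu0 : probability T R) I = 1%E -> fmeas X ->
  (forall t, jordan mu0 (X @^-1` [set t])) -> 0 < e ->
  \forall mu \near mu0, (mu : probability T R) I = 1%E ->
    ent (mu : probability T R) X <= ent (mu0 : probability T R) X + e.
Proof.
move=> muI mX jX e0.
pose p0 t := law (mu0 : probability T R) X t.
pose s : R := e / 2 / (#|F|%:R + 1).
have F1 : 0 < #|F|%:R + 1 :> R by rewrite ltr_wpDl.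
have s0 : 0 < s by rewrite !divr_gt0.
pose q t := if p0 t == 0 then s else p0 t.
have q0 t : 0 < q t.
  rewrite /q; case: eqP => // /eqP p0t; rewrite lt_neqAle eq_sym p0t.
  exact: law_ge0.
pose S := \sum_t (`|ln (q t)| + 1).
have S0 : 0 <= S by apply: sumr_ge0 => t _; rewrite addr_ge0.
pose e' := e / 2 / (S + 1).
have e'0 : 0 < e' by rewrite !divr_gt0// ltr_wpDl.
have near_all (r : seq F) : \forall mu \near mu0, (mu : probability T R) I = 1%E ->
    forall t, t \in r -> `|law (mu : probability T R) X t - p0 t| <= e'.
  elim: r => [|t r IH].
    by apply: (filterS _ (@filterT _ (nbhs mu0) _)) => mu _ _ t; rewrite in_nil.
  apply: filterS2 (jordan_near muI (mX t) (jX t) e'0) IH => mu h1 h2 mu1 u.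
  by rewrite inE => /predU1P[->|ur]; [exact: h1|exact: h2].
apply: filterS (near_all (enum F)) => mu nmu mu1.
have h0 : \sum_t (- (p0 t * ln (q t)) + q t - p0 t) <= ent (mu0 : probability T R) X + e / 2.
  have -> : e / 2 = s * (#|F|%:R + 1) by rewrite /s divfK ?gt_eqF.
  apply: (@le_trans _ _ (ent (mu0 : probability T R) X + \sum_(t : F) s)).
    rewrite /ent -big_split/=; apply: ler_sum => t _; rewrite /q.
    case: eqP => [pt|_]; last by rewrite /phi -/(p0 t); have := ltW s0; lra.
    by rewrite -/(p0 t) pt phi0 mul0r; lra.
  by rewrite lerD2l sumr_const -[s *+ _]mulr_natr ler_pM2l// cardT -cardE lerDl.
have h1 : ent (mu : probability T R) X <= \sum_t (- (p0 t * ln (q t)) + q t - p0 t) + e' * S.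
  rewrite /ent /S mulr_sumr -big_split/=; apply: ler_sum => t _.
  apply: le_trans (phi_tangent (law_ge0 _ _ _) (q0 t)) _.
  set p := law _ _ t; have := nmu mu1 t (mem_enum _ _); rewrite -/p => hp.
  have : (p0 t - p) * (ln (q t) + 1) <= e' * (`|ln (q t)| + 1).
    apply: le_trans (ler_norm _) _; rewrite normrM; apply: ler_pM => //.
      by rewrite distrC.
    by rewrite (le_trans (ler_normD _ _))// normr1.
  by lra.
have h2 : e' * S <= e / 2.
  rewrite /e' mulrAC ler_pdivrMr ?ltr_wpDl//.
  by rewrite ler_wpM2l ?lerDl// ltW// divr_gt0.
by lra.
Qed.

End WeakStarContinuity.

Section NullPoints.
Context {R : realType} (mu : probability (measurableTypeR R) R).
Local Notation T := (measurableTypeR R).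

(** More than [k.+1] points of mass at least [k.+1%:R^-1] would have a total mass
    exceeding 1. *)
Lemma finite_heavy_points (k : nat) : finite_set [set t : T | k.+1%:R^-1 <= mass mu [set t]].
Proof.
apply: contrapT => /(infinite_set_fset k.+2)[B BS kB].
have mass_seq (s : seq T) : uniq s -> mass mu [set` s] = \sum_(t <- s) mass mu [set t].
  elim: s => [_|t s IH /= /andP[ts us]].
    by rewrite big_nil set_nil /mass measure0.
  rewrite big_cons -IH//; have ms : measurable [set` s].
    by apply: countable_measurable => //; exact/finite_set_countable/finite_seq.
  apply: EFin_inj; rewrite EFinD -!massE//; last first.
    by apply: countable_measurable => //; exact/finite_set_countable/finite_seq.
  rewrite -measureU//; last by rewrite -subset0 => z /= [->]; rewrite (negbTE ts).
  congr (mu _); apply/seteqP; split=> z /=; rewrite inE.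
    by move=> /predU1P.
  by move=> h; apply/predU1P.
have mB : measurable ([set` finmap.enum_fset B] : set T).
  by apply: countable_measurable => //; exact/finite_set_countable/finite_seq.
have := mass_le1 mu mB; rewrite (mass_seq _ (finmap.fset_uniq B)).
apply/negP; rewrite -ltNge.
apply: (@lt_le_trans _ _ (\sum_(t <- finmap.enum_fset B) (k.+1%:R : R)^-1)).
  rewrite big_const_seq count_predT iter_addr_0 -[_ *+ _]mulr_natl ltr_pdivlMr//.
  by rewrite mul1r ltr_nat.
rewrite big_seq [X in _ <= X]big_seq; apply: ler_sum => t tB; exact: BS.
Qed.

(** There are at most countably many atoms, and an interval is uncountable. *)
Lemma null_point (x y : R) : x < y -> exists2 t, x < t < y & mu [set t] = 0%E.
Proof.
move=> xy; apply: contrapT => H.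
have : countable (`]x, y[%classic : set R).
  apply: (@sub_countable _ _ _ (\bigcup_k [set t : T | k.+1%:R^-1 <= mass mu [set t]])).
  - apply: subset_card_le => t; rewrite /= in_itv/= => xty.
    have mt : 0 < mass mu [set t].
      rewrite lt_neqAle mass_ge0 andbT eq_sym; apply/eqP => m0; apply: H.
      by exists t => //; rewrite massE// m0.
    exists (Num.truncn (mass mu [set t])^-1) => //=.
    by rewrite -[leRHS]invrK lef_pV2 ?posrE ?invr_gt0// ltW// truncnS_gt.
  - apply: bigcup_countable => // k _.
    by apply: finite_set_countable; exact: finite_heavy_points.
move=> /countable_lebesgue_measure0; rewrite lebesgue_measure_itv/= lte_fin xy.
by move/eqP; rewrite -EFinB eqe subr_eq0 gt_eqF.
Qed.

End NullPoints.

(** * From partitions of the interval to variables on the line *)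

Section Partitions.
Context {R : realType} (a b : R) (f : R -> R) (ab : a < b).
Local Notation I := `[a, b]%classic.
Local Notation T := (measurableTypeR R).
Context (fI : forall x, I x -> I (f x)) (cf : {within I, continuous f}).
Context (mu : probability T R) (muI : mu I = 1%E)
  (mu_inv : forall A : set T, measurable A -> mu (I `&` f @^-1` A) = mu A).

Local Notation g := (f \o clamp a b : T -> T).

Lemma measurable_extension : measurable_fun setT g.
Proof.
apply: (continuous_measurable_fun (f := f \o clamp a b)).
by apply: continuous_clamp => //; exact: ltW.
Qed.

Lemma extension_invariant (A : set T) : measurable A -> mu (g @^-1` A) = mu A.
Proof.
move=> mA; have mgA : measurable (g @^-1` A).
  by rewrite -[X in measurable X]setTI; exact: measurable_extension.
rewrite -(measureI_full _ muI)// -(mu_inv mA); congr (mu _).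
by apply/seteqP; split=> x [Ix gA]; split=> //; move: gA;
  rewrite /preimage/= clamp_id.
Qed.

Lemma iter_extension n x : I x -> I (iter n f x) /\ iter n g x = iter n f x.
Proof.
move=> Ix; elim: n => [//|n [In e]]; rewrite !iterS e; split; first exact: fI.
by rewrite /= clamp_id.
Qed.

Lemma entropy_partition_rate k (P : 'I_k -> set R) (X : T -> 'I_k) : fmeas X ->
  (forall i, P i = I `&` X @^-1` [set i]) ->
  entropy_partition I f mu P = entropy_rate mu g X.
Proof.
move=> mX PX; congr (lim (_ @ \oo)); apply/funext => n; congr (_ / _).
rewrite /entropyn /ent -sumrN; apply: eq_bigr => w _.
have -> : fine (mu (cylinder I f P w)) = law mu (block g X n) w.
  rewrite /law /mass; congr fine.
  rewrite -[RHS](measureI_full _ muI)//; last exact: (fmeas_block measurable_extension mX).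
  congr (mu _); apply/seteqP; split=> x /=.
    move=> [Ix h]; split=> //; apply/ffunP => i; rewrite ffunE.
    by have := h i; rewrite PX (iter_extension i Ix).2 => -[].
  move=> [Ix wx]; split=> // i; rewrite PX; have [Ifx e] := iter_extension i Ix.
  by split=> //=; rewrite -e -wx ffunE.
by [].
Qed.

(** Off the interval the variable takes the value of an arbitrary cell, which
    exists as the interval is not empty. *)
Lemma partition_variable k (P : 'I_k -> set T) : measurable_partition I P ->
  exists2 X : T -> 'I_k, fmeas X & forall i, P i = I `&` X @^-1` [set i].
Proof.
move=> [mP tP PI].
have Ia : I a by rewrite /= in_itv/= lexx ltW.
have [i0 _ _] : (\bigcup_i P i) a by rewrite PI.
have IP x : I x <-> exists i, P i x.
  by rewrite -PI; split=> [[i _ Pix]|[i Pix]]; exists i.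
pose X x := odflt i0 [pick i | `[< P i x >]].
have XP i x : P i x -> X x = i.
  move=> Pix; rewrite /X; case: pickP => [j /asboolP Pjx|/(_ i)]; last first.
    by rewrite asboolT.
  by apply: (tP j i) => //; exists x.
have PE i : P i = I `&` X @^-1` [set i].
  apply/seteqP; split=> x /=.
    by move=> Pix; split; [apply/IP; exists i|exact: XP].
  by move=> [/IP[j Pjx] <-]; rewrite (XP j).
exists X => // i.
have X0 x : ~ I x -> X x = i0.
  move=> nI; rewrite /X; case: pickP => // j /asboolP Pjx.
  by exfalso; apply: nI; apply/IP; exists j.
have -> : X @^-1` [set i] = P i `|` (if i == i0 then ~` (I : set T) else set0).
  apply/seteqP; split=> x /=.
    move=> Xi; have [Ix|nI] := pselect (I x); first by left; rewrite PE.
    by right; move: Xi; rewrite X0// => <-; rewrite eqxx.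
  move=> [/XP//|]; case: eqP => // -> ; exact: X0.
by apply: measurableU => //; case: ifP => // _; exact: measurableC.
Qed.

Lemma KS_entropy_le (c : R) :
  (forall k (X : T -> 'I_k), fmeas X -> entropy_rate mu g X <= c) ->
  (KS_entropy I f mu <= c%:E)%E.
Proof.
move=> h; apply: ub_ereal_sup => _ [k [P [mP ->]]].
have [X mX PX] := partition_variable mP.
by rewrite (entropy_partition_rate mX PX) lee_fin h.
Qed.

Lemma entropy_rate_le_KS (F : finType) (X : T -> F) : fmeas X ->
  ((entropy_rate mu g X)%:E <= KS_entropy I f mu)%E.
Proof.
move=> mX; pose Y x := enum_rank (X x).
have mY : fmeas Y by exact: (fmeas_comp (@enum_rank F) mX).
have mg := measurable_extension; have ginv := extension_invariant.
apply: (@le_trans _ _ (entropy_rate mu g Y)%:E).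
  rewrite lee_fin; apply: le_trans (entropy_rate_cent mg ginv mX mY) _.
  rewrite gerDl subr_le0; apply: ent_le => // x y exy.
  by rewrite /joint exy (enum_rank_inj exy).
apply: ereal_sup_ubound; exists #|F|, (fun i => I `&` Y @^-1` [set i]).
split; last by rewrite (entropy_partition_rate mY).
split.
- by move=> i; apply: measurableI => //; exact: mY.
- by move=> i j _ _ [x [[_ /= <-] [_ /= <-]]].
- apply/seteqP; split=> x; first by move=> [i _ []].
  by move=> Ix; exists (Y x).
Qed.

End Partitions.

(** * Upper semicontinuity *)

(** One null cut point is chosen in each interval of a grid of mesh [dl / 2]. *)
Lemma null_mesh {R : realType} (mu : probability (measurableTypeR R) R) (a b dl : R) :
  a < b -> 0 < dl -> exists N (p : 'I_N -> R),
    (forall j, mu [set p j] = 0%E) /\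
    forall x y, `[a, b]%classic x -> `[a, b]%classic y -> thr p x = thr p y ->
      `|x - y| <= dl.
Proof.
move=> ab dl0; pose e := dl / 2; have e0 : 0 < e by rewrite divr_gt0.
have /choice[t tP] : forall j : nat, exists t : R,
    a + j%:R * e < t < a + j.+1%:R * e /\ mu [set t] = 0%E.
  move=> j; have [|t ? ?] := @null_point R mu (a + j%:R * e) (a + j.+1%:R * e).
    by rewrite ltrD2l ltr_pM2r// ltr_nat.
  by exists t.
pose N := (Num.truncn ((b - a) / e)).+2.
exists N, (fun j : 'I_N => t j); split=> [j|]; first by case: (tP j).
suff key x y : `[a, b]%classic x -> `[a, b]%classic y -> x < y ->
    thr (fun j : 'I_N => t j) x = thr (fun j : 'I_N => t j) y -> y - x <= dl.
  move=> x y xI yI exy; have [xy|yx|->] := ltgtP x y.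
  - by rewrite distrC gtr0_norm ?subr_gt0//; exact: key.
  - by rewrite gtr0_norm ?subr_gt0//; exact: key.
  - by rewrite subrr normr0 ltW.
rewrite /= !in_itv/= => /andP[ax xb] /andP[ay yb] xy /ffunP exy.
rewrite leNgt; apply/negP => dxy.
pose j := (Num.truncn ((x - a) / e)).+1.
have jN : (j < N)%N.
  by rewrite !ltnS; apply: le_truncn; rewrite ler_pM2r ?invr_gt0// lerD2r.
have := exy (Ordinal jN); rewrite !ffunE/=.
have [/andP[t1 t2] _] := tP j.
have /truncn_itv/andP[j1 j2] : 0 <= (x - a) / e by rewrite divr_ge0 ?subr_ge0// ltW.
rewrite ler_pdivlMr// in j1; rewrite ltr_pdivrMr// -/j in j2.
have xt : x <= t j by move: t1 j2; lra.
have -> : (x <= t j) = true by [].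
move=> /esym; apply/negP; rewrite -ltNge; apply: lt_trans t2 _.
by rewrite /j -!natr1; move: j1 dxy; rewrite /e; lra.
Qed.

Section CriticalNeighborhoods.
Context {R : realType} (I : set R) (f : R -> R) (V : nat -> set R).

Lemma near_critical (dl : R) : shrinking_open_nbhds I (critical_set I f) V ->
  0 < dl -> \forall m \near \oo, forall x, V m x ->
    exists2 y, critical_set I f y & `|x - y| < dl.
Proof.
move=> [_ _ _ cV] dl0.
have nb : nbhs (0%E : \bar R) [set z | (z < dl%:E)%E].
  by apply: open_nbhs_nbhs; split; [exact: open_ereal_lt_ereal|rewrite /= lte_fin].
have near_lt : \forall m \near \oo,
    (hausdorff_dist (V m) (critical_set I f) < dl%:E)%E by exact: (cV _ nb).
apply: filterS near_lt => m hm x Vx.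
have : (edist_inf (critical_set I f) x < dl%:E)%E.
  apply: le_lt_trans hm; rewrite /hausdorff_dist 2!le_max; apply/orP; right.
  by apply/orP; left; apply: ereal_sup_ubound; exists x.
by move=> /ereal_inf_lt[_ [y cy <-]] /edist_lt_ball xy; exists y.
Qed.

End CriticalNeighborhoods.

Lemma jordan_block {R : realType} (mu : probability (measurableTypeR R) R)
    (g : R -> R) N (p : 'I_N -> R) n (w : {ffun 'I_n -> {ffun 'I_N -> bool}}) :
  continuous g ->
  (forall B : set (measurableTypeR R), measurable B -> mu (g @^-1` B) = mu B) ->
  (forall j, mu [set p j] = 0%E) -> jordan mu (block g (thr p) n @^-1` [set w]).
Proof.
move=> cg mu_inv p0.
have jiter i A : jordan mu A -> jordan mu (iter i g @^-1` A).
  move=> jA; elim: i => [//|i IH].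
  rewrite (_ : iter i.+1 g @^-1` A = g @^-1` (iter i g @^-1` A)).
    exact: jordan_preimage.
  by apply/funext => x; rewrite /preimage/= -iterSr.
have -> : block g (thr p) n @^-1` [set w] =
    \bigcap_(i in [set: 'I_n]) (iter i g @^-1` (\bigcap_(j in [set: 'I_N])
      (if w i j then [set x | x <= p j] else ~` [set x | x <= p j]))).
  apply/seteqP; split => x /=.
    move=> <- i _ j _; rewrite !ffunE.
    by case: ifP => //= /negbT/negP.
  move=> h; apply/ffunP => i; rewrite ffunE; apply/ffunP => j; rewrite ffunE.
  have := h i Logic.I j Logic.I.
  by case: (w i j) => [->//|/negP/negbTE].
apply: (jordan_bigcap (jordanT mu)) => i; apply: jiter.
apply: (jordan_bigcap (jordanT mu)) => j; have := jordan_itv (p0 j).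
by case: (w i j) => //; exact: jordanC.
Qed.

Section Semicontinuity.
Context {R : realType} (a b r : R) (f : R -> R) (V : nat -> set R) (eta : nat -> R).
Local Notation I := (`[a, b]%classic : set R).
Local Notation T := (measurableTypeR R).
Context (ab : a < b) (r1 : 1 < r) (fI : forall x, I x -> I (f x))
  (smooth : smooth_in I r f) (nbhsV : shrinking_open_nbhds I (critical_set I f) V)
  (eta_gt0 : forall m, 0 < eta m) (eta0 : eta @ \oo --> (0 : R)).

(** All constants are chosen before the measure: [s] for the bounded part of the
    entropy of the labels, then [m] to make [eta m] and the derivative on [V m]
    small, and finally [dl] from the lower bound on the derivative off
    [V m]. *)
Lemma uniform_tail (e : R) : 0 < e -> exists2 dl : R, 0 < dl &
  forall N (p : 'I_N -> R),
    (forall x y, I x -> I y -> thr p x = thr p y -> `|x - y| <= dl) ->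
  forall mu : probability T R, invariant_prob_eta I f V eta mu ->
  forall (F : finType) (X : T -> F), fmeas X ->
    entropy_rate mu (f \o clamp a b) X <=
    entropy_rate mu (f \o clamp a b) (thr p) + e.
Proof.
move=> e0; have [df ch hh] := smooth_in_deriv ab r1 smooth.
have ba0 : 0 <= b - a by rewrite subr_ge0 ltW.
have [A [gamma [A1 g0 res]]] := hoelder_resolution ba0 hh.
have /choice[d dP] : forall k : nat, exists d : R, [/\ 0 < d,
    forall x y, I x -> I y -> `|x - y| <= d ->
      `|deriv_in I f x - deriv_in I f y| < expR (- (k.+1)%:R) &
    (b - a) / d + 1 <= A * expR (gamma * k%:R)].
  by move=> k; have [d d0 [h1 h2]] := res k; exists d.
have d0 k : 0 < d k by case: (dP k).
have dosc k x y : I x -> I y -> `|x - y| <= d k ->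
  `|deriv_in I f x - deriv_in I f y| < expR (- (k.+1)%:R) by case: (dP k) => _ + _; exact.
have dA k : (b - a) / d k + 1 <= A * expR (gamma * k%:R) by case: (dP k).
pose s := Num.min 1 (e / 8).
have s0 : 0 < s by rewrite lt_min ltr01 divr_gt0.
have s1 : s <= 1 by rewrite ge_min lexx.
have se : 4 * s <= e / 2.
  have : s <= e / 8 by rewrite ge_min lexx orbT.
  by lra.
pose D := 1 + gamma + ln A - ln s.
have D0 : 0 < D.
  have := ln_ge0 A1; have := ln_le0 s1; rewrite /D.
  by move: g0; lra.
have eD0 : 0 < e / 2 / D by rewrite !divr_gt0.
have near1 : \forall m \near \oo, eta m < e / 2 / D.
  move/cvgrPdist_lt : eta0 => /(_ _ eD0); apply: filterS => m.
  by rewrite sub0r normrN gtr0_norm.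
(* within d 0 of a critical point the derivative is less than expR (-1) *)
have near2 := near_critical nbhsV (d0 0%N).
have [m [etam Vm]] := filter_ex (filterI near1 near2).
have [oV SV _ _] := nbhsV; have [U oU VU] := oV m.
have hV x : (U `&` I) x -> `|deriv_in I f x| <= expR (-1).
  rewrite -VU => Vx; have [y [Iy hy] xy] := Vm x Vx.
  have Ix : I x by move: Vx; rewrite VU => -[].
  have := dosc 0%N x y Ix Iy (ltW xy); rewrite hy subr0.
  exact: ltW.
have zU x : I x -> deriv_in I f x = 0 -> U x.
  move=> Ix hx; suff : V m x by rewrite VU => -[].
  by apply: SV; split.
have [c c0 hc] := deriv_away ch oU zU.
pose k0 := Num.truncn `|ln c|.
have hU x : I x -> ~ U x -> expR (- (k0.+1)%:R) <= `|deriv_in I f x|.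
  move=> Ix nU; apply: le_trans (hc x Ix nU).
  rewrite -[leRHS]lnK ?posrE// ler_expR.
  have : `|ln c| < k0.+1%:R by exact: truncnS_gt.
  by have := ler_norm (- ln c); rewrite normrN; lra.
exists (d k0) => // N p mesh mu [[muI etamu] [_ inv]] F X mX.
have cf := derivable_in_continuous df.
have ginv := extension_invariant ab cf muI inv.
have im : (`| \int[mu]_(x in U `&` I) lne (`|deriv_in I f x|)%:E | <= (eta m)%:E)%E.
  by rewrite -VU; exact: etamu.
have s01 : 0 < s <= 1 by rewrite s0.
have := entropy_rate_tail ab df ch ginv muI oU hV im A1 g0 d0 dosc dA hU s01 mesh mX.
rewrite -/D => h; apply: (le_trans h); rewrite lerD2l.
have : eta m * D <= e / 2 by rewrite -ler_pdivlMr// ltW.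
by lra.
Qed.

Lemma upper_semicontinuous_KS :
  upper_semicontinuous
    (fun mu : set_type (invariant_prob_eta I f V eta) =>
       KS_entropy I f (set_val mu)).
Proof.
move=> x c hx; have [df _ _] := smooth_in_deriv ab r1 smooth.
have cf := derivable_in_continuous df.
have Mx : invariant_prob_eta I f V eta (set_val x) by exact: set_mem (valP x).
set mu0 : probability T R := set_val x in hx Mx.
have [c' hc' c'c] : exists2 c' : R, (KS_entropy I f mu0 <= c'%:E)%E & c' < c.
  move: hx; case: (KS_entropy I f mu0) => [k|//|].
  - by rewrite lte_fin => kc; exists k.
  - by move=> _; exists (c - 1); rewrite ?leNye// ltrBlDr ltrDl.
pose e := (c - c') / 4; have e0 : 0 < e by rewrite divr_gt0// subr_gt0.
have [dl dl0 tail] := uniform_tail e0.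
have [N [p [p0 mesh]]] := null_mesh mu0 ab dl0.
have Mx' := Mx; case: Mx' => -[muI _] [_ inv].
have ginv := extension_invariant ab cf muI inv.
have mg : measurable_fun setT (f \o clamp a b : T -> T) by exact: measurable_extension.
have cg : continuous (f \o clamp a b) by apply: continuous_clamp => //; exact: ltW.
have mp : fmeas (T := T) (thr p) by exact: fmeas_thr.
have h0 : entropy_rate mu0 (f \o clamp a b) (thr p) <= c'.
  rewrite -lee_fin; apply: le_trans hc'.
  exact: (entropy_rate_le_KS ab fI cf muI inv mp).
have [cv _] := cvg_entropy_rate mg ginv mp.
have [n n0 hn] : exists2 n, (0 < n)%N &
    ent mu0 (block (f \o clamp a b) (thr p) n) <= n%:R * (c' + e).
  move/cvgrPdist_lt : cv => /(_ _ e0)[k _ hk]; exists k.+1 => //.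
  have := hk k.+1 (leqnSn k); rewrite /= ltr_distlC => /andP[_ h].
  have : ent mu0 (block (f \o clamp a b) (thr p) k.+1) / k.+1%:R <= c' + e.
    by rewrite ltW// (lt_le_trans h)// lerD2r.
  by rewrite ler_pdivrMr// mulrC.
have n0' : 0 < n%:R :> R by rewrite ltr0n.
have ne0 : 0 < n%:R * e by rewrite mulr_gt0.
have mI : measurable (I : set T) by [].
have near0 : \forall mu \near (set_val x : weak_star I), (mu : probability T R) I = 1%E ->
    ent (mu : probability T R) (block (f \o clamp a b) (thr p) n) <=
    ent mu0 (block (f \o clamp a b) (thr p) n) + n%:R * e.
  apply: ent_near => //; first exact: fmeas_block.
  by move=> w; exact: jordan_block.
have near_x : \forall y \near x, (set_val y : probability T R) I = 1%E ->
    ent (set_val y : probability T R) (block (f \o clamp a b) (thr p) n) <=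
    ent mu0 (block (f \o clamp a b) (thr p) n) + n%:R * e.
  exact: (@initial_continuous _ _ (@set_val _ (invariant_prob_eta I f V eta)) x _ near0).
apply: filterS near_x => y /= hy.
have My : invariant_prob_eta I f V eta (set_val y) by exact: set_mem (valP y).
set mu : probability T R := set_val y in hy My *.
have My' := My; case: My' => -[muI' _] [_ inv'].
have ginv' := extension_invariant ab cf muI' inv'.
apply: (@le_lt_trans _ _ (c' + 3 * e)%:E); last by rewrite lte_fin /e; lra.
apply: (KS_entropy_le ab fI cf muI') => k X mX.
have h1 := tail N p mesh mu My _ X mX.
have [_ h2] := cvg_entropy_rate mg ginv' mp.
have h3 := h2 n n0; have h4 := hy muI'.
suff : entropy_rate mu (f \o clamp a b) (thr p) <= c' + 2 * e by lra.
rewrite -(ler_pM2l n0').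
by lra.
Qed.

End Semicontinuity.

Theorem theorem1p3 (R : realType) (a b r : R) (f : R -> R)
    (V : nat -> set R) (eta : nat -> R)
    (I := `[a, b]%classic : set R) :
  a < b ->
  1 < r ->
  (forall x, I x -> I (f x)) ->
  smooth_in I r f ->
  shrinking_open_nbhds I (critical_set I f) V ->
  (forall m, 0 < eta m) ->
  eta @ \oo --> (0 : R) ->
  upper_semicontinuous
    (fun mu : set_type (invariant_prob_eta I f V eta) =>
       KS_entropy I f (set_val mu)).
Proof.
move=> ab r1 fI smooth nbhsV eta_gt0 eta0.
exact: (upper_semicontinuous_KS ab r1 fI smooth nbhsV eta_gt0 eta0).
Qed.
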